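(* Let $A=K[x_{n-d+1},\dots,x_n]$ be a Noether normalization of $R/I$. Then $R/I$ is Cohen–Macaulay if and only if $x_{n-d+1},\dots,x_n$ do not divide any minimal generator of $\mathrm{in}(I)$.
   Context: $K$ is an infinite field, $R=K[x_1,\dots,x_n]$, $\omega=(\omega_1,\dots,\omega_n)\in(\mathbb Z^+)^n$, $I\subset R$ is an ideal homogeneous for the grading $\deg_\omega(x_i)=\omega_i$, and $d=\dim(R/I)\ge1$. That $A$ is a Noether normalization of $R/I$ means that $A\hookrightarrow R/I$ is an integral ring extension. $\mathrm{in}(I)$ is the initial ideal of $I$ with respect to the weighted degree reverse lexicographic order $>_\omega$: $x^\alpha>_\omega x^\beta$ iff $\deg_\omega(x^\alpha)>\deg_\omega(x^\beta)$, or these degrees are equal and the last nonzero entry of $\alpha-\beta$ is negative. Minimal generators of the monomial ideal $\mathrm{in}(I)$ are its minimal monomial generators; the condition says that none of the variables $x_{n-d+1},\dots,x_n$ divides any of them. *)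

(* Defs.v *)
From HB Require Import structures.
From mathcomp Require Import all_boot all_order all_algebra.
From mathcomp Require Import ring_quotient.
From mathcomp Require Import mpoly.

Set Implicit Arguments.
Unset Strict Implicit.
Unset Printing Implicit Defensive.

Import GRing.Theory.

Local Open Scope ring_scope.
Local Open Scope quotient_scope.

Definition infinite_type (T : eqType) : Prop :=
  forall s : seq T, exists x : T, x \notin s.

Section CommutativeRings.
Variable S : comNzRingType.
Implicit Types (P Q M J : {pred S}) (s : seq S) (G : S -> Prop).

Definition generated_ideal G (x : S) : Prop :=
  exists2 s : seq (S * S),
    forall q, q \in s -> G q.2 & x = \sum_(q <- s) q.1 * q.2.

(* idealr_closed already requires the ideal to be proper, whereas
   prime_idealr_closed is only the multiplicative condition. *)
Definition prime_ideal P : Prop := idealr_closed P /\ prime_idealr_closed P.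

Definition maximal_ideal M : Prop :=
  idealr_closed M /\
  forall J, idealr_closed J -> {subset M <= J} -> {subset J <= M}.

Definition strict_subset P Q : Prop :=
  {subset P <= Q} /\ exists2 x, x \in Q & x \notin P.

(* C 0 < C 1 < ... < C k, a chain of length k (with k strict inclusions) *)
Definition prime_chain k (C : 'I_k.+1 -> {pred S}) : Prop :=
  (forall i, prime_ideal (C i)) /\
  (forall i j : 'I_k.+1, (i < j)%N -> strict_subset (C i) (C j)).

Definition is_krull_dim (d : nat) : Prop :=
  (exists C : 'I_d.+1 -> {pred S}, prime_chain C) /\
  (forall k (C : 'I_k.+1 -> {pred S}), prime_chain C -> (k <= d)%N).

Definition is_height P (h : nat) : Prop :=
  (exists2 C : 'I_h.+1 -> {pred S}, prime_chain C & C ord_max =i P) /\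
  (forall k (C : 'I_k.+1 -> {pred S}),
     prime_chain C -> C ord_max =i P -> (k <= h)%N).

(* Each entry is a nonzerodivisor modulo the previous ones, and the sequence
   does not generate the unit ideal. *)
Definition regular_sequence s : Prop :=
  (forall k, (k < size s)%N ->
     forall z, generated_ideal (fun g => g \in take k s) (z * s`_k) ->
               generated_ideal (fun g => g \in take k s) z) /\
  ~ generated_ideal (fun g => g \in s) 1.

(* g is the maximal length of a regular sequence contained in J. *)
Definition is_grade J (g : nat) : Prop :=
  (exists s, [/\ regular_sequence s, {subset s <= J} & size s = g]) /\
  (forall s, regular_sequence s -> {subset s <= J} -> (size s <= g)%N).

(* The definition of a Cohen-Macaulay ring in Kaplansky (Commutative Rings,
   3-1) and Eisenbud (Commutative Algebra, 18.2), for a Noetherian ring S: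
   grade M = height M for every maximal ideal M.  S is not required to be
   Noetherian here; it is only used for quotients of K[x_1, ..., x_n]. *)
Definition cohen_macaulay : Prop :=
  forall M, maximal_ideal M -> exists2 h : nat, is_height M h & is_grade M h.

End CommutativeRings.

Section WeightedOrder.
Variables (n : nat) (w : 'I_n -> nat).
Implicit Types a b : 'X_{1..n}.

Definition wdeg a : nat := (\sum_(i < n) w i * a i)%N.

Fact wdeg0 : wdeg 0%MM = 0%N.
Proof. by rewrite /wdeg big1 // => i _; rewrite mnm0E muln0. Qed.

Fact wdegD : {morph wdeg : a b / (a + b)%MM >-> (a + b)%N}.
Proof.
move=> a b; rewrite /wdeg -big_split /=.
by apply: eq_bigr => i _; rewrite mnmDE mulnDr.
Qed.

HB.instance Definition _ := isMeasure.Build n wdeg wdeg0 wdegD.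

(* x^a > x^b for the weighted degree reverse lexicographic order *)
Definition wrevlex_gt a b : Prop :=
  (wdeg b < wdeg a)%N \/
  wdeg a = wdeg b /\
  exists i : 'I_n, (a i < b i)%N /\ forall j : 'I_n, (i < j)%N -> a j = b j.

Variable K : fieldType.
Implicit Types (I : {pred {mpoly K[n]}}) (f : {mpoly K[n]}).

(* I contains the weighted homogeneous components of its elements. *)
Definition whomogeneous_ideal I : Prop :=
  forall f, f \in I -> forall e : nat, pihomog wdeg e f \in I.

Definition initial_monomial f a : Prop :=
  a \in msupp f /\ forall b, b \in msupp f -> b != a -> wrevlex_gt a b.

Definition initial_ideal I : {mpoly K[n]} -> Prop :=
  generated_ideal (fun g => exists f a,
    [/\ f \in I, initial_monomial f a & g = 'X_[K, a]]).

End WeightedOrder.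

Section MonomialIdeals.
Variables (n : nat) (K : fieldType).
Implicit Types (J : {mpoly K[n]} -> Prop) (G : 'X_{1..n} -> Prop).

Definition monomially_generated_by J G : Prop :=
  forall p, J p <-> generated_ideal (fun g => exists2 a, G a & g = 'X_[K, a]) p.

(* x^a belongs to an inclusion-minimal set of monomials generating J. *)
Definition minimal_generator J (a : 'X_{1..n}) : Prop :=
  exists G, [/\ monomially_generated_by J G,
    forall G', (forall b, G' b -> G b) -> monomially_generated_by J G' ->
               forall b, G b -> G' b
    & G a].

End MonomialIdeals.

Section NoetherNormalization.
Variables (n d : nat) (d_le_n : (d <= n)%N).

(* Indices start at 0, so this is the index of x_{n-d+1+j}, for 0 <= j < d. *)
Definition last_var (j : 'I_d) : 'I_n :=
  cast_ord (subnK d_le_n) (rshift (n - d) j).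

Variables (K : fieldType) (I : idealr {mpoly K[n]}).

(* K[x_{n-d+1}, ..., x_n] -> K[x_1, ..., x_n] / I, the domain being identified
   with a polynomial ring in d variables *)
Definition last_vars_map (p : {mpoly K[d]}) : {ideal_quot I} :=
  \pi_({ideal_quot I}) (p \mPo [tuple 'X_(last_var j) | j < d]).

Definition last_vars_noether_normalization : Prop :=
  injective last_vars_map /\ integralRange last_vars_map.

End NoetherNormalization.

(* Main.v *)
(* Write S = R/I and t_1, ..., t_d for the last d variables. For the weighted
   reverse lexicographic order, both sides of the equivalence amount to the
   regularity of t_d, ..., t_1 on S.

   If no minimal generator of in(I) involves a t_j, then multiplication by
   the t_j preserves the span N of the standard monomials, and R = I + N is a
   direct sum. By Zariski's lemma a maximal ideal of S contains a monic
   f_j(t_j) for each j; these are regular on R (divide with remainder by each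
   f_j), hence on N, which is isomorphic to S. A regular sequence of length d = dim S in a maximal
   ideal forces both its height and its grade to be d.

   Conversely, let m be the image of (x_1, ..., x_n). Going up from A gives
   ht m >= d, so a Cohen-Macaulay S has a regular sequence y of length >= d in
   m. By integrality and homogeneity the y's are nilpotent modulo (t), so that
   the Koszul homology of t on S, which they annihilate up to powers, vanishes
   in positive degrees. As I is homogeneous, Nakayama's lemma makes
   t_d, ..., t_1 a regular sequence. If x_i is the last variable dividing in(f)
   for a homogeneous f in I, then x_i is one of the t_j as soon as some t_j
   divides in(f); now f = x_i g modulo the later variables, and regularity
   puts g in I modulo these variables, so that in(f)/x_i is in in(I). *)
From HB Require Import structures.
Require Import Defs.
From mathcomp Require Import all_boot all_order all_algebra.
From mathcomp Require Import ring_quotient.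
From mathcomp Require Import mpoly ring zify.
From mathcomp Require boolp classical_sets.

Set Implicit Arguments.
Unset Strict Implicit.
Unset Printing Implicit Defensive.

Import GRing.Theory.

Local Open Scope ring_scope.
Local Open Scope quotient_scope.

(** * Ideals, primes and regular sequences *)

(** Unlike [idealr_closed], this is [Prop]-valued and admits the unit ideal, so that every generated
    ideal qualifies. *)
Definition ideal_pred (B : nzRingType) (J : B -> Prop) : Prop :=
  J 0 /\ forall a u v, J u -> J v -> J (a * u + v).

Section Ideals.
Variable B : comNzRingType.
Implicit Types (J L G T : B -> Prop) (P M : {pred B}) (l s : seq B).

Section IdealPredTheory.
Variables (J : B -> Prop) (idJ : ideal_pred J).

Lemma ideal_pred0 : J 0. Proof. by case: idJ. Qed.

Lemma ideal_predD u v : J u -> J v -> J (u + v).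
Proof. by move=> Ju Jv; rewrite -[u]mul1r; apply: idJ.2. Qed.

Lemma ideal_predMl a u : J u -> J (a * u).
Proof. by move=> Ju; rewrite -[a * u]addr0; apply: idJ.2; last case: idJ. Qed.

Lemma ideal_predMr a u : J u -> J (u * a).
Proof. by rewrite mulrC; apply: ideal_predMl. Qed.

Lemma ideal_predN u : J u -> J (- u).
Proof. by rewrite -mulN1r; apply: ideal_predMl. Qed.

Lemma ideal_predB u v : J u -> J v -> J (u - v).
Proof. by move=> Ju /ideal_predN; apply: ideal_predD. Qed.

Lemma ideal_pred_sum (I : eqType) (r : seq I) (p : pred I) (F : I -> B) :
  (forall i, i \in r -> p i -> J (F i)) -> J (\sum_(i <- r | p i) F i).
Proof.
move=> JF; rewrite big_seq_cond; apply: big_ind => [||i /andP[]].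
- exact: ideal_pred0.
- exact: ideal_predD.
- exact: JF.
Qed.

Lemma ideal_pred_eqmod u v : J (u - v) -> J v -> J u.
Proof. by move=> Juv Jv; rewrite -(subrK v u); apply: ideal_predD. Qed.

End IdealPredTheory.

Lemma idealr_closed_pred P : idealr_closed P -> ideal_pred (fun x => x \in P).
Proof. by case=> P0 _ PD; split=> // a u v uP vP; apply: PD. Qed.

Lemma generated_ideal_pred G : ideal_pred (generated_ideal G).
Proof.
split=> [|a u v [s1 Gs1 ->] [s2 Gs2 ->]]; first by exists [::]; rewrite ?big_nil.
exists ([seq (a * q.1, q.2) | q <- s1] ++ s2).
  by move=> q; rewrite mem_cat => /orP[/mapP[q' /Gs1 Gq' ->]|/Gs2].
rewrite big_cat big_map mulr_sumr /=; congr (_ + _).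
by apply: eq_bigr => q _; rewrite mulrA.
Qed.

Lemma generated_idealP G x : G x -> generated_ideal G x.
Proof.
move=> Gx; exists [:: (1, x)]; first by move=> q; rewrite inE => /eqP ->.
by rewrite big_seq1 mul1r.
Qed.

Lemma generated_ideal_min G J x :
  ideal_pred J -> (forall g, G g -> J g) -> generated_ideal G x -> J x.
Proof.
move=> idJ GJ [s Gs ->]; apply: ideal_pred_sum => // q /Gs Gq _.
exact/(ideal_predMl idJ)/GJ.
Qed.

Lemma generated_ideal_mono G1 G2 x : (forall g, G1 g -> generated_ideal G2 g) ->
  generated_ideal G1 x -> generated_ideal G2 x.
Proof. by apply: generated_ideal_min; apply: generated_ideal_pred. Qed.

(** Stands for the ideal (l) of B/J, kept inside B so that iterated quotients need not be formed. *)
Definition add_ideal J l : B -> Prop :=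
  generated_ideal (fun g => J g \/ g \in l).

Lemma add_ideal_pred J l : ideal_pred (add_ideal J l).
Proof. exact: generated_ideal_pred. Qed.

Lemma add_ideal_sub J l x : J x -> add_ideal J l x.
Proof. by move=> Jx; apply: generated_idealP; left. Qed.

Lemma add_ideal_mem J l x : x \in l -> add_ideal J l x.
Proof. by move=> lx; apply: generated_idealP; right. Qed.

Lemma add_ideal_min J l L x : ideal_pred L -> (forall y, J y -> L y) ->
  (forall y, y \in l -> L y) -> add_ideal J l x -> L x.
Proof. by move=> idL JL lL; apply: generated_ideal_min => // g [/JL|/lL]. Qed.

Lemma add_ideal_mono J1 J2 l1 l2 x : (forall y, J1 y -> add_ideal J2 l2 y) ->
  (forall y, y \in l1 -> add_ideal J2 l2 y) -> add_ideal J1 l1 x -> add_ideal J2 l2 x.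
Proof. by move=> h1 h2; apply: add_ideal_min => //; apply: add_ideal_pred. Qed.

Lemma add_ideal_nil J x : ideal_pred J -> add_ideal J [::] x -> J x.
Proof. by move=> idJ; apply: add_ideal_min. Qed.

Lemma add_ideal_cons J y l x : ideal_pred J ->
  add_ideal J (y :: l) x <-> exists c, add_ideal J l (x - c * y).
Proof.
move=> idJ; have idl := add_ideal_pred J l; have idyl := add_ideal_pred J (y :: l).
split=> [|[c cP]].
  apply: (@add_ideal_min _ _ (fun x => exists c, add_ideal J l (x - c * y))).
  - split=> [|a u v [c cP] [e eP]].
      by exists 0; rewrite mul0r subr0; apply: ideal_pred0.
    exists (a * c + e).
    have -> : a * u + v - (a * c + e) * y = a * (u - c * y) + (v - e * y) by ring.
    exact: idl.2.
  - by move=> z Jz; exists 0; rewrite mul0r subr0; apply: add_ideal_sub.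
  - move=> z; rewrite inE => /orP[/eqP ->|lz].
      by exists 1; rewrite mul1r subrr; apply: ideal_pred0.
    by exists 0; rewrite mul0r subr0; apply: add_ideal_mem.
rewrite -(subrK (c * y) x) addrC; apply: idyl.2.
  by apply: add_ideal_mem; rewrite mem_head.
apply: add_ideal_mono cP => z; first exact: add_ideal_sub.
by move=> lz; apply: add_ideal_mem; rewrite inE lz orbT.
Qed.

Lemma add_ideal1 J y x : ideal_pred J ->
  add_ideal J [:: y] x <-> exists c, J (x - c * y).
Proof.
move=> idJ; rewrite add_ideal_cons //; split=> -[c cP]; exists c.
  exact: add_ideal_nil.
exact: add_ideal_sub.
Qed.

Lemma add_ideal_cat J l1 l2 x :
  add_ideal (add_ideal J l1) l2 x <-> add_ideal J (l1 ++ l2) x.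
Proof.
split; apply: add_ideal_min; try exact: add_ideal_pred.
- move=> y; apply: add_ideal_mono => z; first exact: add_ideal_sub.
  by move=> lz; apply: add_ideal_mem; rewrite mem_cat lz.
- by move=> y ly; apply: add_ideal_mem; rewrite mem_cat ly orbT.
- by move=> y Jy; do 2!apply: add_ideal_sub.
- move=> y; rewrite mem_cat => /orP[] ly; last exact: add_ideal_mem.
  by apply: add_ideal_sub; apply: add_ideal_mem.
Qed.

(** Weak regularity on B/J, read off in B; J + (s) may be the unit ideal. *)
Definition regular_mod J s : Prop := forall k, (k < size s)%N ->
  forall z, add_ideal J (take k s) (z * s`_k) -> add_ideal J (take k s) z.

Lemma regular_mod_cons J y s : ideal_pred J -> regular_mod J (y :: s) ->
  (forall z, J (z * y) -> J z) /\ regular_mod (add_ideal J [:: y]) s.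
Proof.
move=> idJ reg; split=> [z Jzy | k k_lt z /add_ideal_cat zP].
  exact/(add_ideal_nil idJ)/(reg 0%N isT)/add_ideal_sub.
exact/add_ideal_cat/(reg k.+1).
Qed.

(** * Prime ideals, maximal ideals and chains of primes *)

Definition mult_closed T : Prop := T 1 /\ forall u v, T u -> T v -> T (u * v).

(* Krull: an ideal maximal among those disjoint from T is prime. *)
Lemma prime_avoiding J T : ideal_pred J -> mult_closed T ->
    (forall x, J x -> ~ T x) ->
  exists P, [/\ prime_ideal P, forall x, J x -> x \in P & forall x, T x -> x \notin P].
Proof.
move=> idJ [T1 TM] JT.
pose good L := [/\ ideal_pred L, forall x, J x -> L x & forall x, L x -> ~ T x].
(* The empty set is admitted for the sake of the union of an empty chain. *)
pose ok L := good L \/ forall x, ~ L x.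
have [|L [okL maxL]] := @classical_sets.Zorn_bigcup B ok.
  move=> F Fok Ftot.
  have [[L FL [gL1 gL2 gL3]]|noL] :=
      boolp.pselect (exists2 L, F L & good L); last first.
    right=> x [L FL Lx]; have [gL|/(_ x)//] := Fok L FL.
    by apply: noL; exists L.
  left; split.
  - split=> [|a u v [L1 FL1 L1u] [L2 FL2 L2v]]; first by exists L; case: gL1.
    have idl L' : F L' -> forall x, L' x -> ideal_pred L'.
      by move=> FL' x L'x; case: (Fok L' FL') => [[]|/(_ x)].
    have [L12|L21] := Ftot L1 L2 FL1 FL2.
      by exists L2 => //; apply: (idl L2 FL2 v L2v).2 => //; apply: L12.
    by exists L1 => //; apply: (idl L1 FL1 u L1u).2 => //; apply: L21.
  - by move=> x Jx; exists L => //; apply: gL2.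
  - by move=> x [L' FL' L'x]; case: (Fok L' FL') => [[_ _]|/(_ x)//]; apply.
have gJ : good J by split.
have gL : good L.
  case: okL => // L0; case: (maxL J); last by left.
  by split=> [x /L0//|/(_ 0 (ideal_pred0 idJ))/L0].
(* By maximality, L + (x) meets T as soon as x is outside L. *)
have {}maxL x : ~ L x -> exists2 y, T y & exists c, L (y - c * x).
  move=> nLx; apply: boolp.contrapT => nT.
  have [idL JL LT] := gL.
  case: (maxL (add_ideal L [:: x])).
    split=> [y|/(_ x)]; first exact: add_ideal_sub.
    by move=> h; apply/nLx/h/add_ideal_mem; rewrite inE.
  left; split; first exact: add_ideal_pred.
    by move=> y /JL; apply: add_ideal_sub.
  by move=> y /(add_ideal1 _ _ idL) cP Ty; apply: nT; exists y.
have [idL JL LT] := gL.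
exists (fun x => boolp.asbool (L x)); split.
- have pP x : (x \in (fun x => boolp.asbool (L x))) = boolp.asbool (L x) by [].
  split; first split.
  + by rewrite pP; apply/boolp.asboolP; apply: ideal_pred0.
  + by rewrite pP; apply/boolp.asboolP => /LT.
  + move=> a u v; rewrite !pP => /boolp.asboolP Lu /boolp.asboolP Lv.
    by apply/boolp.asboolP; apply: idL.2.
  move=> u v; rewrite !pP => /boolp.asboolP Luv.
  apply/orP; apply: boolp.contrapT => nuv.
  have /maxL[y Ty [c cP]] : ~ L u.
    by move=> Lu; apply: nuv; left; apply/boolp.asboolP.
  have /maxL[z Tz [e eP]] : ~ L v.
    by move=> Lv; apply: nuv; right; apply/boolp.asboolP.
  (* With y in T congruent to c u, and z in T congruent to e v modulo L, the product y z is
     congruent to c e u v, so it lies in both L and T. *)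
  apply: (LT (y * z)); last exact: TM.
  have -> : y * z = (y - c * u) * z + (c * u * (z - e * v) + c * e * (u * v)) by ring.
  apply: ideal_predD => //; first exact: ideal_predMr.
  by apply: ideal_predD => //; apply: ideal_predMl.
- by move=> x /JL Lx; apply/boolp.asboolP.
- by move=> x Tx; apply/boolp.asboolP => /LT.
Qed.

Lemma prime_ideal_pred P : prime_ideal P -> ideal_pred (fun x => x \in P).
Proof. by case=> /idealr_closed_pred. Qed.

Lemma prime_ideal_notin1 P : prime_ideal P -> 1 \notin P.
Proof. by case=> -[]. Qed.

Lemma prime_idealX P x k : prime_ideal P -> x ^+ k \in P -> x \in P.
Proof.
move=> prP; elim: k => [|k IH]; first by rewrite expr0 (negPf (prime_ideal_notin1 prP)).
by rewrite exprS => /prP.2 /orP[].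
Qed.

Lemma prime_ideal_notinM P x y :
  prime_ideal P -> x \notin P -> y \notin P -> x * y \notin P.
Proof. by move=> prP nx ny; apply/negP => /prP.2; rewrite (negPf nx) (negPf ny). Qed.

(** Otherwise M + (x) would be a proper ideal, and maximality would put x in M. *)
Lemma maximal_ideal_inv M x : maximal_ideal M -> x \notin M ->
  exists c, c * x - 1 \in M.
Proof.
move=> [idM maxM] xM; have idM' := idealr_closed_pred idM.
apply: boolp.contrapT => nc.
pose J : {pred B} := fun y => boolp.asbool (add_ideal (fun y => y \in M) [:: x] y).
have JP y : reflect (add_ideal (fun y => y \in M) [:: x] y) (y \in J).
  exact: boolp.asboolP.
have idJ := add_ideal_pred (fun y => y \in M) [:: x].
suff /maxM MJ : idealr_closed J.
  case/negP: xM; apply: MJ; first by move=> y My; apply/JP; apply: add_ideal_sub.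
  by apply/JP; apply: add_ideal_mem; rewrite inE.
split; first by apply/JP; case: idJ.
  apply/JP => /(add_ideal1 _ _ idM')[c cP]; apply: nc; exists c.
  by rewrite -opprB; apply: (ideal_predN idM' cP).
by move=> a u v /JP Ju /JP Jv; apply/JP; apply: idJ.2.
Qed.

Lemma maximal_ideal_prime M : maximal_ideal M -> prime_ideal M.
Proof.
move=> maxM; have idM := idealr_closed_pred maxM.1.
split=> [|u v uvM]; first by case: maxM.
case: (boolP (u \in M)) => //= /(maximal_ideal_inv maxM)[c cM].
have -> : v = c * (u * v) - (c * u - 1) * v by ring.
by apply: (ideal_predB idM); [apply: (ideal_predMl idM) | apply: (ideal_predMr idM)].
Qed.

(** The lower bound k for the height of P, as in the first half of [is_height]. *)
Definition chain_to k P : Prop :=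
  exists2 C : 'I_k.+1 -> {pred B}, prime_chain C & C ord_max =i P.

Lemma chain_to0 P : prime_ideal P -> chain_to 0 P.
Proof.
move=> prP; exists (fun _ => P) => //; split=> // i j.
by rewrite !ord1.
Qed.

Lemma chain_toS k P Q : chain_to k P -> prime_ideal Q -> strict_subset P Q ->
  chain_to k.+1 Q.
Proof.
move=> [C [prC ltC] CP] prQ [PQ [x xQ xP]].
pose C' (i : 'I_k.+2) := if unlift ord_max i is Some j then C j else Q.
have C'l j : C' (lift ord_max j) = C j by rewrite /C' liftK.
have C'm : C' ord_max = Q by rewrite /C' unlift_none.
exists C'; last by rewrite C'm.
split=> [i|i j]; first by case: (unliftP ord_max i) => [i'|] ->; rewrite ?C'l ?C'm.
case: (unliftP ord_max i) => [i'|] ->; case: (unliftP ord_max j) => [j'|] ->.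
- by rewrite !C'l !lift_max; apply: ltC.
- rewrite C'l C'm => _; have subC : {subset C i' <= C ord_max}.
    have := leq_ord i'; rewrite leq_eqVlt => /orP[/eqP eqi|lti].
      by have -> : i' = ord_max by apply: val_inj.
    by have [] := ltC i' ord_max lti.
  split=> [y /subC|]; first by rewrite CP => /PQ.
  by exists x => //; apply: contra xP => /subC; rewrite CP.
- by move=> h; have := ltn_ord (lift ord_max j'); rewrite ltnS leqNgt h.
- by rewrite ltnn.
Qed.

(* A prime minimal over (s_1, ..., s_k) cannot contain the nonzerodivisor
   s_(k+1), so that each entry of s lengthens the chain. *)
Lemma regular_sequence_chain s P : regular_sequence s -> prime_ideal P ->
  {subset s <= P} -> chain_to (size s) P.
Proof.
move=> [reg _] prP sP.
suff chain k Q : (k <= size s)%N -> prime_ideal Q -> {subset take k s <= Q} ->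
    chain_to k Q by apply: chain => //; rewrite take_size.
elim: k Q => [|k IH] Q k_le prQ tQ; first exact: chain_to0.
pose J := generated_ideal (fun g => g \in take k s).
have tkQ : {subset take k s <= Q}.
  by move=> x xk; apply: tQ; rewrite (take_nth 0) // mem_rcons inE xk orbT.
have JQ x : J x -> x \in Q.
  exact: (generated_ideal_min (prime_ideal_pred prQ)).
have regX j z : J (z * s`_k ^+ j) -> J z.
  by elim: j z => [|j IHj] z; rewrite ?mulr1 // exprS mulrA => /IHj /reg; apply.
(* A prime avoiding all products u s_k^j with u outside Q is contained in Q and misses [s_k]. Such a
   product cannot lie in J, since regularity would put u in J, hence in Q. *)
have [||x Jx [u uQ [j xE]]|Q' [prQ' JQ' TQ']] :=
    @prime_avoiding J (fun x => exists2 u, u \notin Q & exists j, x = u * s`_k ^+ j).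
- exact: generated_ideal_pred.
- split; first by exists 1; [apply: prime_ideal_notin1 | exists 0%N; rewrite mulr1].
  move=> _ _ [u uQ [i ->]] [v vQ [j ->]]; exists (u * v).
    exact: prime_ideal_notinM.
  by exists (i + j)%N; rewrite exprD mulrACA.
- by case/negP: uQ; apply/JQ/(regX j); rewrite -xE.
apply: (chain_toS (P := Q')) => //.
  apply: IH => //; first exact: ltnW.
  by move=> x xk; apply: JQ'; apply: generated_idealP.
split=> [x xQ'|].
  by apply: contraLR xQ' => xQ; apply: TQ'; exists x => //; exists 0%N; rewrite mulr1.
exists s`_k; first by apply: tQ; rewrite (take_nth 0) // mem_rcons mem_head.
apply: TQ'; exists 1; first exact: prime_ideal_notin1.
by exists 1%N; rewrite mul1r expr1.
Qed.

(** Any regular sequence in P yields a chain of primes of the same length, so dim B bounds both the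
    grade and the height of P; s attains the bound. *)
Lemma height_grade_of_regular d P s : is_krull_dim B d -> prime_ideal P ->
  regular_sequence s -> {subset s <= P} -> size s = d -> is_height P d /\ is_grade P d.
Proof.
move=> [_ dimB] prP reg sP sd; split; split.
- by rewrite -sd; apply: regular_sequence_chain.
- by move=> k C /dimB.
- by exists s.
- by move=> s' reg' s'P; have [C /dimB] := regular_sequence_chain reg' prP s'P.
Qed.

End Ideals.

(** * Koszul complexes *)

Section Koszul.
Variables (B : comNzRingType) (T : Type) (t : T -> B).
Implicit Types (J : B -> Prop) (js : seq T).

(* The total Koszul complex of t_1, ..., t_m, built as an iterated mapping
   cone: an element (a, b) stands for a + e_1 b, with e_1 in degree 1. *)
Fixpoint koszul (m : nat) : lmodType B :=
  if m is m'.+1 then (koszul m' * koszul m')%type else B^o.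

(** The differential of the cone of multiplication by [t j]; the minus sign makes its square
    vanish. *)
Fixpoint kdiff js : koszul (size js) -> koszul (size js) :=
  match js with
  | [::] => fun _ => 0
  | j :: js' => fun x => (kdiff x.1 + t j *: x.2, - kdiff x.2)
  end.

(** Equality in the Koszul complex over B/J is congruence modulo [kmod J] in the complex over B. *)
Fixpoint kmod J m : koszul m -> Prop :=
  match m with
  | 0 => fun x => J x
  | m'.+1 => fun x => kmod J x.1 /\ kmod J x.2
  end.

(* the components of x of degree less than i vanish *)
Fixpoint kfil m (i : nat) : koszul m -> Prop :=
  match m with
  | 0 => fun x => if i is 0 then True else x = 0
  | m'.+1 => fun x => kfil i x.1 /\ kfil i.-1 x.2
  end.

Fixpoint kscalar m (z : B) : koszul m :=
  if m is m'.+1 then (kscalar m' z, 0) else z.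

Fixpoint kdeg0 m : koszul m -> B :=
  if m is m'.+1 then fun x => kdeg0 x.1 else fun x => x.

Lemma koszul_eq m (x y : koszul m.+1) : x.1 = y.1 -> x.2 = y.2 -> x = y.
Proof. by case: x y => [x1 x2] [y1 y2] /= -> ->. Qed.

Lemma kdiff_linear js : linear (@kdiff js).
Proof.
elim: js => [|j js IH] a u v; first by rewrite /kdiff scaler0 addr0.
apply: koszul_eq; last first.
  change (- kdiff (a *: u.2 + v.2) = a *: - kdiff u.2 - kdiff v.2).
  by rewrite IH opprD scalerN.
change (kdiff (a *: u.1 + v.1) + t j *: (a *: u.2 + v.2) =
  a *: (kdiff u.1 + t j *: u.2) + (kdiff v.1 + t j *: v.2)).
rewrite IH !scalerDr !scalerA [t j * a]mulrC -!addrA; congr (_ + _).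
by rewrite addrCA.
Qed.

HB.instance Definition _ js :=
  GRing.isLinear.Build B (koszul (size js)) (koszul (size js)) _ (@kdiff js) (@kdiff_linear js).

Lemma kdiffK js x : kdiff (@kdiff js x) = 0.
Proof.
elim: js x => [|j js IH] x //.
apply: koszul_eq; last first.
  by change (- kdiff (- kdiff x.2) = 0); rewrite raddfN /= IH !oppr0.
change (kdiff (kdiff x.1 + t j *: x.2) + t j *: - kdiff x.2 = 0).
by rewrite linearD linearZ /= IH add0r scalerN subrr.
Qed.

Lemma kmod_ideal J m a (u v : koszul m) : ideal_pred J ->
  kmod J u -> kmod J v -> kmod J (a *: u + v).
Proof.
move=> idJ; elim: m u v => [|m IH] u v /=; first exact: idJ.2.
by move=> [u1 u2] [v1 v2]; split; apply: IH.
Qed.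

Lemma kmod0 J m : ideal_pred J -> kmod J (0 : koszul m).
Proof. by move=> [J0 _]; elim: m => [|m IH] //=; split. Qed.

Lemma kmodZ J m a (u : koszul m) : ideal_pred J -> kmod J u -> kmod J (a *: u).
Proof.
by move=> idJ Ju; rewrite -[_ *: _]addr0; apply: kmod_ideal => //; apply: kmod0.
Qed.

Lemma kmodD J m (u v : koszul m) :
  ideal_pred J -> kmod J u -> kmod J v -> kmod J (u + v).
Proof. by move=> idJ Ju Jv; rewrite -[u]scale1r; apply: kmod_ideal. Qed.

Lemma kmodB J m (u v : koszul m) :
  ideal_pred J -> kmod J u -> kmod J v -> kmod J (u - v).
Proof.
by move=> idJ Ju Jv; rewrite addrC -scaleN1r; apply: kmod_ideal.
Qed.

Lemma kmod_sub J1 J2 m (u : koszul m) :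
  (forall z, J1 z -> J2 z) -> kmod J1 u -> kmod J2 u.
Proof. by move=> J12; elim: m u => [|m IH] u /=; [apply: J12 | case=> /IH ? /IH]. Qed.

Lemma kmodZr J m a (u : koszul m) : ideal_pred J -> J a -> kmod J (a *: u).
Proof.
move=> idJ Ja; elim: m u => [|m IH] u /=; last by split.
exact: ideal_predMr.
Qed.

Lemma kmod_reg J m y (u : koszul m) :
  (forall z, J (z * y) -> J z) -> kmod J (y *: u) -> kmod J u.
Proof.
move=> reg; elim: m u => [|m IH] u /=; last by case=> /IH ? /IH.
by move=> Jyu; apply: reg; rewrite mulrC.
Qed.

Lemma kfil_ideal m i a (u v : koszul m) : kfil i u -> kfil i v -> kfil i (a *: u + v).
Proof.
elim: m i u v => [|m IH] i u v /=.
  by case: i => // i -> ->; rewrite scaler0 addr0.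
by move=> [u1 u2] [v1 v2]; split; apply: IH.
Qed.

Lemma kfil0 m i : kfil i (0 : koszul m).
Proof. by elim: m i => [|m IH] i /=; [case: i | split]. Qed.

Lemma kfilZ m i a (u : koszul m) : kfil i u -> kfil i (a *: u).
Proof. by move=> fu; rewrite -[_ *: _]addr0; apply: kfil_ideal => //; apply: kfil0. Qed.

Lemma kfilD m i (u v : koszul m) : kfil i u -> kfil i v -> kfil i (u + v).
Proof. by move=> fu fv; rewrite -[u]scale1r; apply: kfil_ideal. Qed.

Lemma kfilB m i (u v : koszul m) : kfil i u -> kfil i v -> kfil i (u - v).
Proof. by move=> fu fv; rewrite addrC -scaleN1r; apply: kfil_ideal. Qed.

Lemma kfilT m (u : koszul m) : kfil 0 u.
Proof. by elim: m u => [|m IH] u //=; split. Qed.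

Lemma kfil_big m i (u : koszul m) : (m < i)%N -> kfil i u -> u = 0.
Proof.
elim: m i u => [|m IH] [|i] // u mi [fa fb].
by apply: koszul_eq; [apply: IH fa; apply: ltnW | apply: IH fb].
Qed.

Lemma kfil_kdiff js i x : kfil i.+1 x -> kfil i (@kdiff js x).
Proof.
elim: js i x => [|j js IH] i x /=; first by case: i.
move=> [x1 x2]; split; first by apply: kfilD; [apply: IH | apply: kfilZ].
case: i x1 x2 => [|i] _ x2; first exact: kfilT.
by rewrite -scaleN1r; apply/kfilZ/IH.
Qed.

(** The cofactor of y is chosen componentwise, and as 0 in the degrees below i, which keeps v in the
    filtration. *)
Lemma kmod_add1 J m i y (u : koszul m) : ideal_pred J -> kfil i u ->
  kmod (add_ideal J [:: y]) u -> exists2 v, kfil i v & kmod J (u - y *: v).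
Proof.
move=> idJ; elim: m i u => [|m IH] i u /=.
  case: i => [_ /(add_ideal1 _ _ idJ)[c cP]|i -> _].
    by exists c => //; change (J ((u : B) - y * c)); rewrite mulrC.
  by exists 0 => //; rewrite scaler0 subrr; apply: ideal_pred0.
move=> [/IH u1 /IH u2] [/u1[v1 fv1 v1P] /u2[v2 fv2 v2P]].
by exists (v1, v2).
Qed.

Lemma kdiff_mod J js x : ideal_pred J -> kmod J x -> kmod J (@kdiff js x).
Proof.
move=> idJ; elim: js x => [|j js IH] x /=; first by case: idJ.
move=> [x1 x2]; split; first by apply: kmodD => //; [apply: IH | apply: kmodZ].
by rewrite -scaleN1r; apply: kmodZ => //; apply: IH.
Qed.

(** Exterior multiplication by the basis vector e_k, a null-homotopy of multiplication by t_k. The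
    value on the empty list is a dummy. *)
Fixpoint khomotopy js (k : nat) : koszul (size js) -> koszul (size js) :=
  match js, k with
  | [::], _ => fun x => x
  | j :: js', 0 => fun x => (0, x.1)
  | j :: js', k'.+1 => fun x => (khomotopy k' x.1, - khomotopy k' x.2)
  end.

Lemma khomotopy_linear js k : linear (@khomotopy js k).
Proof.
elim: js k => [|j js IH] k a u v //; case: k => [|k]; apply: koszul_eq.
- by change (0 = a *: 0 + 0 :> koszul (size js)); rewrite scaler0 addr0.
- by [].
- exact: IH.
change (- khomotopy k (a *: u.2 + v.2) = a *: - khomotopy k u.2 - khomotopy k v.2).
by rewrite IH opprD scalerN.
Qed.

HB.instance Definition _ js k :=
  GRing.isLinear.Build B (koszul (size js)) (koszul (size js)) _
    (@khomotopy js k) (@khomotopy_linear js k).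

Lemma khomotopyP js k x j0 : (k < size js)%N ->
  kdiff (@khomotopy js k x) + khomotopy k (kdiff x) = t (nth j0 js k) *: x.
Proof.
elim: js k x => [|j js IH] [|k] x // k_lt; apply: koszul_eq.
- change (kdiff 0 + t j *: x.1 + 0 = t j *: x.1).
  by rewrite raddf0 add0r addr0.
- change (- kdiff x.1 + (kdiff x.1 + t j *: x.2) = t j *: x.2).
  by rewrite addKr.
- change (kdiff (khomotopy k x.1) + t j *: - khomotopy k x.2 +
    khomotopy k (kdiff x.1 + t j *: x.2) = t (nth j0 js k) *: x.1).
  by rewrite -IH // linearD linearZ /= scalerN addrACA addNr addr0.
- change (- kdiff (- khomotopy k x.2) - khomotopy k (- kdiff x.2) =
    t (nth j0 js k) *: x.2).
  by rewrite -IH // !raddfN /= !opprK.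
Qed.

Lemma khomotopy_mod J js k x : ideal_pred J -> kmod J x -> kmod J (@khomotopy js k x).
Proof.
move=> idJ; elim: js k x => [|j js IH] [|k] x //= [x1 x2].
  by split=> //; apply: kmod0.
by split; [apply: IH | rewrite -scaleN1r; apply: kmodZ => //; apply: IH].
Qed.

Lemma khomotopy_fil js k i x : (k < size js)%N -> kfil i x -> kfil i.+1 (@khomotopy js k x).
Proof.
elim: js k i x => [|j js IH] [|k] i x //= k_lt [x1 x2].
  by split=> //; apply: kfil0.
split; first exact: IH.
rewrite -scaleN1r; apply: kfilZ; case: i x1 x2 => [|i] _ x2; first exact: kfilT.
exact: IH.
Qed.

(** Vanishing of the homology of the Koszul complex over B/J in all degrees at least i. As the
    differential is homogeneous, the filtration can replace the grading. *)
Definition kacyclic J js i := forall f, kfil i f -> kmod J (@kdiff js f) ->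
  exists2 g, kfil i.+1 g & kmod J (f - kdiff g).

(** The z that annihilate the class of f form an ideal, which contains J, and contains each t_k
    because of [khomotopy]. *)
Lemma koszul_annihilator J js i f z : ideal_pred J ->
  kfil i f -> kmod J (@kdiff js f) -> add_ideal J (map t js) z ->
  exists2 g, kfil i.+1 g & kmod J (z *: f - kdiff g).
Proof.
move=> idJ fi Jf.
apply: (@add_ideal_min _ _ _
  (fun z => exists2 g, kfil i.+1 g & kmod J (z *: f - kdiff g))).
- split=> [|a u v [g gi gP] [h hi hP]].
    by exists 0; [apply: kfil0 | rewrite scale0r raddf0 subrr; apply: kmod0].
  exists (a *: g + h); first exact: kfil_ideal.
  have -> : (a * u + v) *: f - kdiff (a *: g + h) =
      a *: (u *: f - kdiff g) + (v *: f - kdiff h).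
    by rewrite linearP /= scalerDl scalerBr scalerA opprD addrACA.
  exact: kmod_ideal.
- move=> y Jy; exists 0; first exact: kfil0.
  by rewrite raddf0 subr0; apply: kmodZr.
- move=> y; case: js f fi Jf => [|j1 js1] f fi Jf //; set js := j1 :: js1 in f fi Jf *.
  move=> /(nthP (t j1))[k]; rewrite size_map => k_lt <-.
  rewrite (nth_map j1) //; exists (khomotopy k f); first exact: khomotopy_fil.
  rewrite -(khomotopyP _ j1 k_lt) addrAC subrr add0r.
  exact: khomotopy_mod.
Qed.

(** As y is regular on B/J, the long exact sequence for B/J, B/J and B/(J + (y)) makes y injective
    on homology in degrees at least i. But y^N annihilates this homology. *)
Lemma kacyclic_step J js y N i : ideal_pred J -> (forall z, J (z * y) -> J z) ->
  add_ideal J (map t js) (y ^+ N) ->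
  kacyclic (add_ideal J [:: y]) js i.+1 -> kacyclic J js i.
Proof.
move=> idJ reg yN acy f fi Jf.
(* If y f' = d g modulo J, then g is a cycle modulo J + (y), so g = d h + y u modulo J for some h
   and u. Then y (f' - d u) vanishes modulo J, and y cancels. *)
have yinj (f' : koszul (size js)) : kfil i f' ->
    (exists2 g, kfil i.+1 g & kmod J (y *: f' - kdiff g)) ->
    exists2 g, kfil i.+1 g & kmod J (f' - kdiff g).
  move=> fi' [g gi gP].
  have [||h hi hP] := acy g => //.
    have -> : kdiff g = y *: f' - (y *: f' - kdiff g) by rewrite opprB addrC subrK.
    have idy := add_ideal_pred J [:: y].
    apply: kmodB => //; first by apply: kmodZr => //; apply: add_ideal_mem; rewrite inE.
    by apply: kmod_sub gP; apply: add_ideal_sub.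
  have fgh : kfil i.+1 (g - kdiff h) by apply: kfilB => //; apply: kfil_kdiff.
  have [u ui uP] := kmod_add1 idJ fgh hP.
  exists u => //; apply: kmod_reg reg _.
  have -> : y *: (f' - kdiff u) = (y *: f' - kdiff g) + kdiff (g - kdiff h - y *: u).
    have -> : kdiff (g - kdiff h - y *: u) = kdiff g - y *: kdiff u.
      by rewrite !raddfB /= kdiffK subr0 linearZ.
    by rewrite scalerBr addrA subrK.
  by apply: kmodD => //; apply: kdiff_mod.
have [g gi gP] := koszul_annihilator idJ fi Jf yN.
elim: N {yN} g gi gP => [|N IH] g gi gP; first by exists g; rewrite // -[f]scale1r.
have [|g' gi' gP'] := yinj (y ^+ N *: f) (kfilZ _ fi).
  by exists g => //; rewrite scalerA -exprS.
exact: IH gi' gP'.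
Qed.

(** Depth sensitivity: the complex is zero above degree [size js], and each entry of the regular
    sequence ys lowers the range of acyclicity by one degree. *)
Lemma koszul_acyclic J js ys i : ideal_pred J -> regular_mod J ys ->
  (forall y, y \in ys -> exists N, add_ideal J (map t js) (y ^+ N)) ->
  (size js < i + size ys)%N -> kacyclic J js i.
Proof.
elim: ys J i => [|y ys IH] J i idJ reg ysN szi.
  move=> f fi _; exists 0; first exact: kfil0.
  rewrite addn0 in szi; rewrite (kfil_big szi fi) raddf0 subrr; exact: kmod0.
have [regy reg'] := regular_mod_cons idJ reg.
have [N yN] := ysN y (mem_head _ _).
apply: (kacyclic_step idJ regy yN); apply: IH => //; first exact: add_ideal_pred.
- move=> z zs; have [|M zM] := ysN z; first by rewrite inE zs orbT.
  exists M; apply: add_ideal_mono zM => x.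
    by move=> Jx; do 2!apply: add_ideal_sub.
  exact: add_ideal_mem.
- by rewrite addSnnS.
Qed.

Lemma kdeg0_kdiff J js x : add_ideal J (map t js) (kdeg0 (@kdiff js x)).
Proof.
elim: js x => [|j js IH] x; first by apply: ideal_pred0; apply: add_ideal_pred.
have idj := add_ideal_pred J (map t (j :: js)).
have kdeg0P m (a : B) (u v : koszul m) : kdeg0 (u + a *: v) = kdeg0 u + a * kdeg0 v.
  by elim: m u v => [|m IHm] u v //=; rewrite IHm.
change (add_ideal J (map t (j :: js)) (kdeg0 (kdiff x.1 + t j *: x.2))).
rewrite kdeg0P; apply: ideal_predD => //.
  apply: add_ideal_mono (IH x.1) => y; first exact: add_ideal_sub.
  by move=> yjs; apply: add_ideal_mem; rewrite inE yjs orbT.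
by apply: ideal_predMr => //; apply: add_ideal_mem; rewrite mem_head.
Qed.

Lemma kdeg0_scalar m z : kdeg0 (kscalar m z) = z.
Proof. by elim: m => [|m IH] //=. Qed.

Lemma kscalarP m a u v : kscalar m (a * u + v) = a *: kscalar m u + kscalar m v.
Proof.
elim: m => [|m IH] //; apply: koszul_eq; first exact: IH.
by change (0 = a *: 0 + 0 :> koszul m); rewrite scaler0 addr0.
Qed.

Lemma kscalar0 m : kscalar m 0 = 0.
Proof. by elim: m => [|m IH] //=; rewrite IH. Qed.

Lemma kscalarZ m a u : kscalar m (a * u) = a *: kscalar m u.
Proof. by rewrite -[a * u]addr0 kscalarP kscalar0 addr0. Qed.

Lemma kdiff_scalar js z : @kdiff js (kscalar _ z) = 0.
Proof.
elim: js => [|j js IH] //; apply: koszul_eq.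
  by change (kdiff (kscalar (size js) z) + t j *: 0 = 0); rewrite IH scaler0 addr0.
by change (- kdiff (0 : koszul (size js)) = 0); rewrite raddf0 oppr0.
Qed.

Lemma kmod_kdeg0 J m (u : koszul m) : kmod J u -> J (kdeg0 u).
Proof. by elim: m u => [|m IH] u //= [/IH]. Qed.

Lemma kmod_scalar J m z : ideal_pred J -> J z -> kmod J (kscalar m z).
Proof. by move=> idJ Jz; elim: m => [|m IH] //=; split=> //; apply: kmod0. Qed.

(** Together with [kdeg0_kdiff], this identifies H_0 with B/(J + (t)). *)
Lemma kdiff_onto J js z : ideal_pred J -> add_ideal J (map t js) z ->
  exists2 x, kfil 1 x & kmod J (@kdiff js x - kscalar _ z).
Proof.
move=> idJ.
apply: (@add_ideal_min _ _ _
  (fun z => exists2 x, kfil 1 x & kmod J (@kdiff js x - kscalar _ z))).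
- split=> [|a u v [x x1 xP] [y y1 yP]].
    exists 0; first exact: kfil0.
    rewrite raddf0 sub0r -scaleN1r; apply: kmodZ => //.
    by apply: kmod_scalar => //; apply: ideal_pred0.
  exists (a *: x + y); first exact: kfil_ideal.
  rewrite linearP kscalarP opprD addrACA -scalerBr.
  exact: kmod_ideal.
- move=> y Jy; exists 0; first exact: kfil0.
  rewrite raddf0 sub0r -scaleN1r; apply: kmodZ => //.
  exact: kmod_scalar.
- move=> y yjs.
  suff [x x1 xE] : exists2 x, kfil 1 x & @kdiff js x = kscalar _ y.
    by exists x; rewrite // xE subrr; apply: kmod0.
  elim: js yjs => [|j js IH] //; rewrite inE => /orP[/eqP ->|/IH[x x1 xE]].
    exists (0, kscalar (size js) 1); first by split; [apply: kfil0 | apply: kfilT].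
    apply: koszul_eq; last first.
      by change (- kdiff (kscalar (size js) 1) = 0); rewrite kdiff_scalar oppr0.
    change (kdiff 0 + t j *: kscalar (size js) 1 = kscalar (size js) (t j)).
    by rewrite raddf0 add0r -kscalarZ mulr1.
  exists (x, 0); first by split=> //; apply: kfil0.
  apply: koszul_eq.
    by change (kdiff x + t j *: 0 = kscalar (size js) y); rewrite scaler0 addr0.
  by change (- kdiff (0 : koszul (size js)) = 0); rewrite raddf0 oppr0.
Qed.

(** The kernel of t_j on H_0 of js is the image of H_1 of j :: js in the cone sequence. *)
Lemma kacyclic_regular J j js : ideal_pred J -> kacyclic J (j :: js) 1 ->
  forall z, add_ideal J (map t js) (z * t j) -> add_ideal J (map t js) z.
Proof.
move=> idJ acy z zP.
have idjs := add_ideal_pred J (map t js).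
have [a a1 aP] : exists2 a, kfil 1 a & kmod J (kdiff a - kscalar (size js) (- (z * t j))).
  by apply: kdiff_onto => //; apply: ideal_predN.
(* A cycle of degree 1 modulo J, since d a cancels t_j z; being a boundary, it makes z a boundary in
   the complex of js. *)
pose f : koszul (size (j :: js)) := (a, kscalar (size js) z).
have [||[g u] [g2 u1] [_ uP]] := acy f.
- by split=> //; apply: kfilT.
- split; last first.
    change (kmod J (- kdiff (kscalar (size js) z))).
    by rewrite kdiff_scalar oppr0; apply: kmod0.
  change (kmod J (kdiff a + t j *: kscalar (size js) z)).
  suff -> : t j *: kscalar (size js) z = - kscalar (size js) (- (z * t j)) by [].
  by rewrite -mulN1r kscalarZ scaleN1r opprK mulrC kscalarZ.
have /kmod_kdeg0 : kmod J (kscalar (size js) z + kdiff u).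
  by rewrite -[kdiff u]opprK.
have kdeg0D m (x y : koszul m) : kdeg0 (x + y) = kdeg0 x + kdeg0 y.
  by elim: m x y => [|m IHm] x y //=.
rewrite kdeg0D kdeg0_scalar => zuP.
rewrite -(addrK (kdeg0 (kdiff u)) z); apply: ideal_predB => //.
  exact: add_ideal_sub.
exact: kdeg0_kdiff.
Qed.

(** In the cone sequence, the homology of js in positive degrees maps to 0 in that of j :: js, so
    t_j acts surjectively on it. *)
Lemma kacyclic_behead J j js : ideal_pred J -> kacyclic J (j :: js) 1 ->
  forall a, kfil 1 a -> kmod J (@kdiff js a) ->
  exists g u, [/\ kfil 2 g, kfil 1 u, kmod J (@kdiff js u) &
    kmod J (a - (kdiff g + t j *: u))].
Proof.
move=> idJ acy a a1 Ja.
pose f : koszul (size (j :: js)) := (a, 0).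
have [||[g u] [g2 u1] [gP uP]] := acy f.
- by split=> //; apply: kfil0.
- split; last by change (kmod J (- kdiff (0 : koszul (size js))));
    rewrite raddf0 oppr0; apply: kmod0.
  by change (kmod J (kdiff a + t j *: 0)); rewrite scaler0 addr0.
exists g, u; split=> //.
have : kmod J (0 + - - kdiff u) by [].
by rewrite opprK add0r.
Qed.

End Koszul.

(** * Zariski's lemma *)

Section Zariski.

(** An integral equation of degree m for a/g is multiplied by g^m; all terms but a^m are then
    multiples of g. *)
Lemma integral_quotient_dvd (D : idomainType) (F : fieldType) (f : {rmorphism D -> F})
    (a g : D) : injective f -> g != 0 ->
  integralOver f (f a / f g) -> exists m h, a ^+ m = g * h.
Proof.
move=> injf g0 [q /monicP q1 /rootP q0].
have fg0 : f g != 0 by rewrite raddf_eq0.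
have sq : size (map_poly f q) = size q by apply: size_map_inj_poly => //; apply: rmorph0.
have q_neq0 : q != 0 by rewrite -lead_coef_eq0 q1 oner_eq0.
pose m := (size q).-1.
exists m, (- \sum_(i < m) q`_i * a ^+ i * g ^+ (m - i).-1).
apply: injf; rewrite rmorphM raddfN raddf_sum mulrN mulr_sumr /= rmorphXn /=.
apply/eqP; rewrite -addr_eq0; apply/eqP.
have := congr1 (fun z => z * f g ^+ m) q0.
rewrite mul0r; apply: etrans; rewrite horner_coef sq (polySpred q_neq0) big_ord_recr /= -/m.
rewrite mulrDl mulr_suml addrC; congr (_ + _).
  apply: eq_bigr => i _; rewrite coef_map /= !rmorphM !rmorphXn /= expr_div_n.
  have -> : f g ^+ m = f g ^+ i * (f g * f g ^+ (m - i).-1).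
    by rewrite -exprS prednK ?subn_gt0 // -exprD subnKC // ltnW.
  by rewrite -mulrA; field; rewrite expf_neq0.
rewrite coef_map /= -/m.
have -> : q`_m = 1 by rewrite -q1 lead_coefE.
by rewrite rmorph1 mul1r expr_div_n divfK // expf_neq0.
Qed.

(** With b the leading coefficient, multiplying the equation by a power of b turns it into a monic
    equation for b y. *)
Lemma integral_lead_coef (D : comNzRingType) (F : comNzRingType) (f : {rmorphism D -> F})
    (p : {poly D}) y : root (map_poly f p) y -> integralOver f (f (lead_coef p) * y).
Proof.
move=> /rootP p0; set b := lead_coef p.
pose m := (size p).-1.
have sp : (size p <= m.+1)%N by apply: leqSpred.
have bE : b = p`_m by [].
have p0E : \sum_(i < m) f p`_i * y ^+ i + f b * y ^+ m = 0.
  apply: (etrans _ p0); rewrite (horner_coef_wide _ (leq_trans (size_poly _ _) sp)) big_ord_recr /=.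
  by rewrite coef_map -bE; congr (_ + _); apply: eq_bigr => i _; rewrite coef_map.
case: {sp}m bE p0E => [|m] bE p0E.
  (* A constant p with a root has a coefficient mapped to 0. *)
  by move: p0E; rewrite big_ord0 add0r mulr1 => ->; rewrite mul0r; apply: integral0.
pose r := \poly_(i < m.+1) (p`_i * b ^+ (m - i)).
exists ('X ^+ m.+1 + r).
  by rewrite monicE lead_coefDl ?lead_coefXn // size_polyXn ltnS size_poly.
rewrite rootE rmorphD /= map_polyXn hornerD hornerXn.
have sr : (size (map_poly f r) <= m.+1)%N.
  by apply: leq_trans (size_poly _ _) (size_poly _ _).
have := congr1 (fun z => f b ^+ m * z) p0E; rewrite mulr0 => p0bE.
apply/eqP/(etrans _ p0bE); rewrite (horner_coef_wide _ sr) mulrDr exprMn addrC.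
congr (_ + _).
  rewrite mulr_sumr; apply: eq_bigr => i _.
  rewrite coef_map coef_poly ltn_ord /= rmorphM rmorphXn exprMn.
  have -> : f b ^+ m = f b ^+ (m - i) * f b ^+ i by rewrite -exprD subnK // -ltnS.
  by ring.
by rewrite exprS; ring.
Qed.

Lemma size_1DXM (D : idomainType) (b : {poly D}) :
  b != 0 -> size (1 + 'X * b) = (size b).+1.
Proof.
move=> b0; rewrite mulrC addrC size_polyDl ?size_mulX // size_poly1 ltnS.
by rewrite lt0n size_poly_eq0.
Qed.

(** Modulo 1 + X b, the polynomial b is invertible with inverse -X. Divisibility would thus make 1 +
    X b, of positive degree, divide the nonzero constant c^k. *)
Lemma mul1X_ndvd (D : idomainType) (b h : {poly D}) (c : D) m k :
  b != 0 -> c != 0 -> (c%:P * b ^+ m) ^+ k != (1 + 'X * b) * h.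
Proof.
move=> b0 c0; apply/eqP => eqh; pose g := 1 + 'X * b.
have [h' h'P] : exists h', (- ('X * b)) ^+ (m * k) = 1 + g * h'.
  have := subrX1 (- ('X * b)) (m * k); set S := \sum_(_ < _) _ => /eqP.
  rewrite subr_eq => /eqP ->; exists (- S); rewrite /g; ring.
have : (c ^+ k)%:P = g * (h * (- 'X) ^+ (m * k) - (c ^+ k)%:P * h').
  rewrite mulrBr mulrA -eqh exprMn -exprM polyC_exp -[_ * b ^+ _ * _]mulrA -exprMn.
  by rewrite mulrN [b * _]mulrC h'P; ring.
move=> /(congr1 (fun p : {poly D} => size p)).
have ck0 : c ^+ k != 0 by rewrite expf_neq0.
rewrite size_polyC ck0 => sz.
have g0 : g != 0 by rewrite -size_poly_eq0 size_1DXM.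
set e := (_ - _) in sz; have [e0|e0] := eqVneq e 0.
  by move: sz; rewrite e0 mulr0 size_poly0.
move: sz; rewrite size_mul // size_1DXM //= => /esym/eqP.
rewrite -[size e]prednK ?lt0n ?size_poly_eq0 // addnS /= eqSS addn_eq0 size_poly_eq0.
by rewrite (negPf b0).
Qed.

(** F is generated as a ring by xs and the fractions of D, put as an induction principle. Allowing
    fractions lets D be replaced by D[x] in the induction of [zariski]. *)
Definition fraction_generated (D : nzRingType) (F : fieldType) (f : D -> F)
    (xs : seq F) : Prop :=
  forall L : F -> Prop, (forall c, L (f c)) -> (forall c, L (f c)^-1) ->
    (forall x, x \in xs -> L x) -> (forall u v, L u -> L v -> L (u + v)) ->
    (forall u v, L u -> L v -> L (u * v)) -> forall v, L v.

(* If x were transcendental over D, the other generators would by induction be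
   algebraic over D[x], hence integral after inverting some b in D[x], and
   1 / (1 + x b) could not be integral over D[x] up to powers of b and
   elements of D. *)
Lemma zariski (D : idomainType) (F : fieldType) (f : {rmorphism D -> F}) (xs : seq F) :
  injective f -> fraction_generated f xs ->
  forall x, x \in xs -> exists2 p : {poly D}, p != 0 & root (map_poly f p) x.
Proof.
elim: {xs}(size xs) {-2}xs (leqnn (size xs)) D f => [|m IH] xs sxs D f injf gen x xxs.
  by case: xs sxs xxs {gen}.
apply: boolp.contrapT => trx.
have cfx : commr_rmorph f x by move=> c; apply: mulrC.
pose f' : {rmorphism {poly D} -> F} := horner_morph cfx.
have injf' : injective f'.
  apply: raddf_inj => p p0; apply/eqP; apply: contraPT p0 => p_neq0 p0.
  by apply: trx; exists p => //; apply/rootP.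
have f'C c : f' c%:P = f c by apply: horner_morphC.
have f'X : f' 'X = x by apply: horner_morphX.
have perm_xs := perm_to_rem xxs; set ys := rem x xs in perm_xs.
have algy y : y \in ys -> exists2 p : {poly {poly D}}, p != 0 & root (map_poly f' p) y.
  apply: (IH ys) => //; first by have := perm_size perm_xs; rewrite -ltnS /= => <-.
  move=> L Lf' Lf'V Lys LD LM; apply: gen => // [c|c|z].
  - by rewrite -f'C.
  - by rewrite -f'C.
  - by rewrite (perm_mem perm_xs) inE => /predU1P[->|/Lys//]; rewrite -f'X.
have [b b0 by_] : exists2 b : {poly D}, b != 0 &
    forall y, y \in ys -> integralOver f' (f' b * y).
  elim: ys algy {perm_xs} => [|y ys IHys] algy; first by exists 1; rewrite ?oner_eq0.
  have [|b b0 bys] := IHys; first by move=> z zys; apply: algy; rewrite inE zys orbT.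
  have [p p0 py] := algy y (mem_head _ _).
  exists (lead_coef p * b); first by rewrite mulf_neq0 // lead_coef_eq0.
  move=> z; rewrite rmorphM inE /= => /predU1P[->|/bys zb].
    rewrite mulrAC; apply: integral_mul; last exact: integral_id.
    exact: integral_lead_coef.
  by rewrite -mulrA; apply: integral_mul => //; apply: integral_id.
(* The elements integral over D[x] up to a factor c b^N form a subring containing all generators,
   hence also 1 / (1 + x b). *)
have := gen (fun v => exists N c, c != 0 /\ integralOver f' (f' (c%:P * b ^+ N) * v)).
have L0 v : integralOver f' v ->
    exists N c, c != 0 /\ integralOver f' (f' (c%:P * b ^+ N) * v).
  by move=> iv; exists 0%N, 1; rewrite mulr1 rmorph1 mul1r oner_eq0.
pose g := 1 + 'X * b.
have g0 : g != 0. by rewrite -size_poly_eq0 size_1DXM.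
case/(_ _ _ _ _ _ (f' g)^-1).
- by move=> c; apply: L0; rewrite -f'C; apply: integral_id.
- move=> c; have [->|c0] := eqVneq c 0.
    by rewrite rmorph0 invr0; apply: L0; apply: integral0.
  exists 0%N, c; split; rewrite // mulr1 f'C divff; first exact: integral1.
  by rewrite raddf_eq0.
- move=> z; rewrite (perm_mem perm_xs) inE => /predU1P[->|/by_ zb].
    by apply: L0; rewrite -f'X; apply: integral_id.
  by exists 1%N, 1; rewrite mul1r expr1 oner_eq0.
- move=> u v [N1 [c1 [c10 i1]]] [N2 [c2 [c20 i2]]].
  exists (N1 + N2)%N, (c1 * c2); split; first by rewrite mulf_neq0.
  have -> : f' ((c1 * c2)%:P * b ^+ (N1 + N2)) * (u + v) =
      f' (c2%:P * b ^+ N2) * (f' (c1%:P * b ^+ N1) * u) +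
      f' (c1%:P * b ^+ N1) * (f' (c2%:P * b ^+ N2) * v).
    by rewrite polyCM exprD !rmorphM /=; ring.
  by apply: integral_add; apply: integral_mul => //; apply: integral_id.
- move=> u v [N1 [c1 [c10 i1]]] [N2 [c2 [c20 i2]]].
  exists (N1 + N2)%N, (c1 * c2); split; first by rewrite mulf_neq0.
  have -> : f' ((c1 * c2)%:P * b ^+ (N1 + N2)) * (u * v) =
      (f' (c1%:P * b ^+ N1) * u) * (f' (c2%:P * b ^+ N2) * v).
    by rewrite polyCM exprD !rmorphM /=; ring.
  exact: integral_mul.
move=> N [c [c0 /integral_quotient_dvd]] [] // k [h /eqP].
exact/negP/mul1X_ndvd.
Qed.

Lemma maximal_ideal_residue_field (S : comNzRingType) (M : {pred S}) :
  maximal_ideal M -> exists (F : fieldType) (f : {rmorphism S -> F}),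
    (forall v, exists s, f s = v) /\ (forall s, f s = 0 <-> s \in M).
Proof.
move=> maxM.
pose I : idealr S := HB.pack (M : S -> bool) (isIdealr.Build S (M : S -> bool) maxM.1).
pose Q := {ideal_quot I}.
have piM (s : S) : (\pi_Q s == 0) = (s \in M).
  by rewrite -[0]pi_zeror -Quotient.idealrBE subr0.
(* The boolean form, with value 0 at 0, lets [xchoose] produce a total inverse. *)
have inv (x : Q) : exists y : Q, if x == 0 then y == 0 else y * x == 1.
  have [_|x0] := eqVneq x 0; first by exists 0.
  have [c cP] : exists c, c * repr x - 1 \in M.
    by apply: maximal_ideal_inv => //; rewrite -piM reprK.
  exists (\pi_Q c); rewrite -[x in _ * x]reprK -rmorphM -subr_eq0.
  by rewrite -(rmorph1 \pi_Q) -rmorphB /= piM.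
have [invQ invQP] : exists invQ : Q -> Q,
    forall x, if x == 0 then invQ x == 0 else invQ x * x == 1.
  by exists (fun x => xchoose (inv x)) => x; exact: (xchooseP (inv x)).
have mulVQ x : x != 0 -> invQ x * x = 1.
  by move=> x0; have := invQP x; rewrite (negPf x0) => /eqP.
have inv0Q : invQ 0 = 0 by have := invQP 0; rewrite eqxx => /eqP.
pose F : fieldType := HB.pack Q (GRing.ComNzRing_isField.Build Q mulVQ inv0Q).
exists F, (\pi_Q : {rmorphism S -> Q}); split.
  by move=> v; exists (repr (v : Q)); exact: (reprK (v : Q)).
by move=> s; rewrite -piM; split=> [->|/eqP].
Qed.

End Zariski.

(** * Univariate polynomials in distinct variables *)

Section PolynomialRing.
Variables (n : nat) (K : idomainType).
Implicit Types (z p : {mpoly K[n]}) (i j : 'I_n) (js : seq 'I_n).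

Lemma mpoly_ring_ind (P : {mpoly K[n]} -> Prop) :
  (forall c, P c%:MP) -> (forall i, P 'X_i) ->
  (forall p q, P p -> P q -> P (p + q)) -> (forall p q, P p -> P q -> P (p * q)) ->
  forall p, P p.
Proof.
move=> PC PX PD PM; apply: mpolyind => [|c m p _ _ Pp]; first by rewrite -mpolyC0.
apply: PD => //; rewrite -mul_mpolyC; apply: (PM) => //.
rewrite mpolyXE_id; apply: (big_ind P) => [||i _]; first by rewrite -mpolyC1.
  exact: PM.
elim: (m i) => [|k Pk]; first by rewrite expr0 -mpolyC1.
by rewrite exprS; apply: PM.
Qed.

Lemma mpoly_rmorph_eq (S : nzRingType) (f g : {rmorphism {mpoly K[n]} -> S}) :
  (forall c, f c%:MP = g c%:MP) -> (forall i, f 'X_i = g 'X_i) -> f =1 g.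
Proof.
move=> fgC fgX; apply: mpoly_ring_ind => // p q fgp fgq.
  by rewrite !rmorphD fgp fgq.
by rewrite !rmorphM fgp fgq.
Qed.

Definition subst_var i (f : {poly K}) : {mpoly K[n]} := (map_poly (@mpolyC n K) f).['X_i].

(** A polynomial in x_i over the other variables; the coefficients are kept in the full ring,
    although x_i does not occur in them. *)
Definition isolate_var i : {mpoly K[n]} -> {poly {mpoly K[n]}} :=
  mmap (polyC \o @mpolyC n K) (fun j => if j == i then 'X else ('X_j)%:P).

HB.instance Definition _ i := GRing.RMorphism.on (isolate_var i).

Lemma isolate_varC i c : isolate_var i c%:MP = c%:MP%:P.
Proof. exact: mmapC. Qed.

Lemma isolate_varX i j : isolate_var i 'X_j = if j == i then 'X else ('X_j)%:P.
Proof. by rewrite /isolate_var mmapX mmap1U. Qed.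

Lemma isolate_varK i z : (isolate_var i z).['X_i] = z.
Proof.
pose g : {rmorphism {mpoly K[n]} -> {mpoly K[n]}} := horner_eval 'X_i \o isolate_var i.
apply: (mpoly_rmorph_eq (f := g) (g := idfun)) => [c|j] /=.
  by rewrite isolate_varC /horner_eval hornerC.
by rewrite isolate_varX /horner_eval; case: eqP => [->|_]; rewrite ?hornerX ?hornerC.
Qed.

Lemma isolate_subst_var i f :
  isolate_var i (subst_var i f) = map_poly (@mpolyC n K) f.
Proof.
rewrite -[isolate_var i _]/((isolate_var i : {rmorphism _ -> _}) _).
rewrite /subst_var -horner_map /= isolate_varX eqxx -map_poly_comp.
rewrite (eq_map_poly (g := polyC \o @mpolyC n K)); last exact: isolate_varC.
by rewrite map_poly_comp -[RHS]comp_polyXr.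
Qed.

Lemma isolate_subst_var_neq i j f : j != i ->
  isolate_var i (subst_var j f) = (subst_var j f)%:P.
Proof.
move=> ji; rewrite -[isolate_var i _]/((isolate_var i : {rmorphism _ -> _}) _).
rewrite /subst_var -horner_map /= isolate_varX (negPf ji) -map_poly_comp.
rewrite (eq_map_poly (g := polyC \o @mpolyC n K)); last exact: isolate_varC.
by rewrite map_poly_comp horner_map.
Qed.

Variables (f : 'I_n -> {poly K}) (monf : forall i, f i \is monic).

Let fR i := map_poly (@mpolyC n K) (f i).
Let g i := subst_var i (f i).

Let monfR i : fR i \is monic.
Proof. exact: monic_map. Qed.

Definition var_rem i z := (Pdiv.Ring.rmodp (isolate_var i z) (fR i)).['X_i].

Lemma var_remD i : {morph var_rem i : z1 z2 / z1 + z2}.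
Proof.
by move=> z1 z2; rewrite /var_rem rmorphD Pdiv.RingMonic.rmodpD // hornerD.
Qed.

Lemma var_rem_mul i z : var_rem i (z * g i) = 0.
Proof.
rewrite /var_rem rmorphM /= isolate_subst_var Pdiv.RingMonic.rmodp_mull ?horner0 //.
exact: monfR.
Qed.

Lemma var_rem_mul_neq i j z : j != i -> var_rem i (z * g j) = var_rem i z * g j.
Proof.
move=> ji; rewrite /var_rem rmorphM /= isolate_subst_var_neq //.
by rewrite mulrC mul_polyC Pdiv.RingMonic.rmodpZ // hornerZ mulrC.
Qed.

Lemma var_rem_sub i z : exists h, z - var_rem i z = h * g i.
Proof.
set h := (Pdiv.Ring.rdivp (isolate_var i z) (fR i)).['X_i]; exists h.
suff {1}-> : z = h * g i + var_rem i z by rewrite addrK.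
have := congr1 (horner_eval 'X_i) (Pdiv.RingMonic.rdivp_eq (monfR i) (isolate_var i z)).
by rewrite rmorphD rmorphM /= /horner_eval isolate_varK.
Qed.

Let rem js z := foldr var_rem z js.

(** Successive remainders by the g_j kill the ideal of the g_j, do not change classes modulo it, and
    commute with multiplication by g_i, which involves another variable. So [rem js z * g i] is 0 in
    a domain. *)
Lemma regular_subst_vars js i z : i \notin js ->
  generated_ideal (fun y => y \in map g js) (z * g i) ->
  generated_ideal (fun y => y \in map g js) z.
Proof.
have idJ js' := generated_ideal_pred (fun y => y \in map g js').
have var_rem0 j : var_rem j 0 = 0.
  by apply: (addrI (var_rem j 0)); rewrite -var_remD !addr0.
have rem0 js' : rem js' 0 = 0 by elim: js' => //= j js' ->.
have remD js' z1 z2 : rem js' (z1 + z2) = rem js' z1 + rem js' z2.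
  by elim: js' => //= j js' ->; rewrite var_remD.
have remM js' j z1 : j \notin js' -> rem js' (z1 * g j) = rem js' z1 * g j.
  elim: js' => //= j' js' IH; rewrite inE negb_or => /andP[jj' /IH ->].
  exact: var_rem_mul_neq.
have remM0 js' j z1 : j \in js' -> rem js' (z1 * g j) = 0.
  elim: js' => //= j' js' IH; rewrite inE.
  have [/IH -> _|jjs'] := boolP (j \in js'); first exact: var_rem0.
  by rewrite orbF => /eqP <-; rewrite remM // var_rem_mul.
have rem_eq js' z1 : generated_ideal (fun y => y \in map g js') (z1 - rem js' z1).
  elim: js' => [|j js' IH] /=; first by rewrite subrr; apply: (ideal_pred0 (idJ [::])).
  have [h hE] := var_rem_sub j (rem js' z1).
  set r := rem js' z1 in h hE IH *.
  have -> : z1 - var_rem j r = h * g j + (z1 - r) by rewrite -hE [RHS]addrC addrA subrK.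
  apply: (idJ (j :: js')).2.
    by apply: generated_idealP; rewrite mem_head.
  by apply: generated_ideal_mono IH => y ys; apply: generated_idealP; rewrite inE ys orbT.
move=> ijs zP.
have : rem js (z * g i) = 0.
  case: zP => s sP ->; elim: s sP => [|[a y] s IH] sP; first by rewrite big_nil.
  rewrite big_cons remD IH ?addr0 => [|q qs]; last by apply: sP; rewrite inE qs orbT.
  by have /mapP[j jjs /= ->] := sP _ (mem_head _ _); apply: remM0.
rewrite remM // => /eqP; rewrite mulf_eq0 => /orP[/eqP r0|/eqP gi0].
  by have := rem_eq js z; rewrite r0 subr0.
have /eqP := isolate_subst_var i (f i); rewrite -/(g i) gi0 rmorph0 eq_sym.
by rewrite (negPf (monic_neq0 (monfR i))).
Qed.

End PolynomialRing.

(** * Initial monomials *)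

Section MonomialOrder.
Variables (n : nat) (w : 'I_n -> nat).
Implicit Types a b c : 'X_{1..n}.

Local Notation "a >w b" := (wrevlex_gt w a b) (at level 70).

Lemma wrevlex_gtxx a : ~ a >w a.
Proof. by case=> [|[_ [i []]]]; rewrite ltnn. Qed.

Lemma wrevlex_gt_trans b a c : a >w b -> b >w c -> a >w c.
Proof.
case=> [ab|[eab [i [abi ab]]]] [bc|[ebc [j [bcj bc]]]].
- by left; apply: ltn_trans bc ab.
- by left; rewrite -ebc.
- by left; rewrite eab.
right; split; first by rewrite eab.
case: (ltngtP i j) => [ij|ji|/val_inj ij].
- exists j; split=> [|k jk]; first by rewrite ab.
  by rewrite ab ?bc // (ltn_trans ij).
- exists i; split=> [|k ik]; first by rewrite -bc.
  by rewrite ab ?bc // (ltn_trans ji).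
- subst j; exists i; split=> [|k ik]; first exact: ltn_trans abi bcj.
  by rewrite ab ?bc.
Qed.

Lemma wrevlex_gt_total a b : a != b -> a >w b \/ b >w a.
Proof.
move=> ab; case: (ltngtP (wdeg w a) (wdeg w b)) => [h|h|e]; first by right; left.
  by left; left.
have [i0 abi0] : exists i, a i != b i.
  apply/existsP; rewrite -negb_forall; apply: contra ab => /forallP abE.
  by apply/eqP/mnmP => i; apply/eqP.
have [i abi imax] := @arg_maxnP _ i0 (fun i => a i != b i) val abi0.
have abj (j : 'I_n) : (i < j)%N -> a j = b j.
  by move=> ij; apply/eqP; apply: contraLR ij => /imax; rewrite -leqNgt.
case: (ltngtP (a i) (b i)) abi => // h _.
  by left; right; split=> //; exists i.
by right; right; split=> //; exists i; split=> // j /abj.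
Qed.

Lemma wdeg_add a b : wdeg w (a + b)%MM = (wdeg w a + wdeg w b)%N.
Proof. exact: wdegD. Qed.

Lemma wdeg_mnm1 i : wdeg w U_(i)%MM = w i.
Proof.
rewrite /wdeg (bigD1 i) //= mnm1E eqxx muln1 big1 ?addn0 // => j ji.
by rewrite mnm1E eq_sym (negPf ji) muln0.
Qed.

Lemma wrevlex_gt_add2r c a b : (a + c)%MM >w (b + c)%MM <-> a >w b.
Proof.
rewrite /wrevlex_gt !wdeg_add ltn_add2r; split=> -[ab|[e [i [abi ab]]]]; try by left.
- right; split; first exact: addIn e.
  exists i; split=> [|j /ab]; first by rewrite !mnmDE ltn_add2r in abi.
  by rewrite !mnmDE => /addIn.
- right; split; first by rewrite e.
  exists i; split=> [|j /ab]; first by rewrite !mnmDE ltn_add2r.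
  by rewrite !mnmDE => ->.
Qed.

Lemma wrevlex_max (s : seq 'X_{1..n}) : s != [::] ->
  exists2 a, a \in s & forall b, b \in s -> b != a -> a >w b.
Proof.
elim: s => // x s IH _; have [->|/IH[a as_ amax]] := eqVneq s [::].
  by exists x => [|b]; rewrite inE ?eqxx // => /eqP ->; rewrite eqxx.
have [xa|xa] := eqVneq x a.
  by exists a => [|b]; rewrite inE ?as_ ?orbT // xa => /predU1P[->|/amax//]; rewrite eqxx.
have [gxa|gax] := wrevlex_gt_total xa.
  exists x => [|b]; rewrite inE ?eqxx // => /predU1P[->|bs _]; first by rewrite eqxx.
  by have [->//|/(amax b bs)] := eqVneq b a; apply: wrevlex_gt_trans.
by exists a => [|b]; rewrite inE ?as_ ?orbT // => /predU1P[->//|/amax].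
Qed.

Hypothesis w_gt0 : forall i, (0 < w i)%N.

Lemma mdeg_le_wdeg a : (mdeg a <= wdeg w a)%N.
Proof. by rewrite mdegE; apply: leq_sum => i _; rewrite leq_pmull. Qed.

(** Positive weights bound the total degree, so only finitely many monomials lie below a given one;
    [rank] counts them. *)
Lemma wrevlex_ind (P : 'X_{1..n} -> Prop) :
  (forall a, (forall b, a >w b -> P b) -> P a) -> forall a, P a.
Proof.
move=> IH a; move: {2}(wdeg w a) (leqnn (wdeg w a)) => N aN.
pose rank a := #|[set b : 'X_{1..n < N.+1} | boolp.asbool (a >w b)]|.
elim: {a}(rank a).+1 {-2}a (ltnSn (rank a)) aN => // m IHm a ltm aN; apply: IH => b ab.
have bN : (wdeg w b <= N)%N.
  by apply: leq_trans aN; case: ab => [/ltnW|[<- _]].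
have bb : (mdeg b < N.+1)%N by rewrite ltnS (leq_trans (mdeg_le_wdeg b)).
rewrite ltnS in ltm; apply: IHm => //; apply: leq_trans ltm; apply: proper_card.
rewrite properE; apply/andP; split.
  apply/subsetP => c; rewrite !inE => /boolp.asboolP bc.
  by apply/boolp.asboolP; apply: wrevlex_gt_trans bc.
apply/negP => /subsetP/(_ (BMultinom bb)); rewrite !inE /= => h.
by have /boolp.asboolP/wrevlex_gtxx := h (boolp.asboolT ab).
Qed.

End MonomialOrder.

(** * Standard polynomials and minimal generators of the initial ideal *)

Section InitialMonomials.
Variables (n : nat) (w : 'I_n -> nat) (K : fieldType) (I : {pred {mpoly K[n]}}).
Hypothesis idI : ideal_pred (fun f => f \in I).
Implicit Types (f z : {mpoly K[n]}) (a b c : 'X_{1..n}).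

Local Notation "a >w b" := (wrevlex_gt w a b) (at level 70).

Definition initial_of a : Prop := exists2 f, f \in I & initial_monomial w f a.

Lemma exists_initial_monomial f : f != 0 -> exists a, initial_monomial w f a.
Proof. by rewrite -msupp_eq0 => /(wrevlex_max w)[a af amax]; exists a. Qed.

Lemma initial_of_add a c : initial_of a -> initial_of (c + a)%MM.
Proof.
move=> [f fI [af amax]]; exists (f * 'X_[c]); first exact: (ideal_predMr idI).
split; first by rewrite (perm_mem (msuppMX f c)) map_f.
move=> b; rewrite (perm_mem (msuppMX f c)) => /mapP[b' /amax b'f ->].
rewrite eqm_add2l => /b'f; rewrite ![(c + _)%MM]addmC.
by move/(wrevlex_gt_add2r w c).
Qed.

Lemma initial_of_le a b : initial_of a -> (a <= b)%MM -> initial_of b.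
Proof. by move=> Ea /submK <-; apply: initial_of_add. Qed.

Definition standard z : Prop := forall b, b \in msupp z -> ~ initial_of b.

Lemma standardD z1 z2 : standard z1 -> standard z2 -> standard (z1 + z2).
Proof.
by move=> s1 s2 b /msuppD_le; rewrite mem_cat => /orP[/s1|/s2].
Qed.

Lemma standardZ (c : K) z : standard z -> standard (c *: z).
Proof. by move=> sz b /msuppZ_le/sz. Qed.

Lemma standard0 : standard 0.
Proof. by move=> b; rewrite msupp0. Qed.

Lemma standard_ideal_eq0 z : standard z -> z \in I -> z = 0.
Proof.
move=> sz zI; apply/eqP; apply: contraT => /exists_initial_monomial[a az].
by case: (sz a); [case: az | exists z].
Qed.

Hypothesis w_gt0 : forall i, (0 < w i)%N.

(** With [standard_ideal_eq0], this is Macaulay's decomposition of R into I and the span of the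
    standard monomials. An initial monomial is rewritten, modulo I, into the smaller monomials of
    some f in I. *)
Lemma standard_division z : exists2 z', standard z' & z - z' \in I.
Proof.
have comb (c : K) z1 z2 : (exists2 z', standard z' & z1 - z' \in I) ->
    (exists2 z', standard z' & z2 - z' \in I) ->
    exists2 z', standard z' & c *: z1 + z2 - z' \in I.
  move=> [z1' s1 I1] [z2' s2 I2]; exists (c *: z1' + z2').
    by apply: standardD => //; apply: standardZ.
  rewrite opprD addrACA -scalerBr -mul_mpolyC; exact: idI.2.
have h0 : exists2 z', standard z' & 0 - z' \in I.
  by exists 0; [apply: standard0 | rewrite subrr; apply: (ideal_pred0 idI)].
have sum_ok (r : seq 'X_{1..n}) (F : 'X_{1..n} -> K) :
    (forall b, b \in r -> exists2 z', standard z' & 'X_[b] - z' \in I) ->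
    exists2 z', standard z' & \sum_(b <- r) F b *: 'X_[b] - z' \in I.
  elim: r => [|b r IHr] rP; first by rewrite big_nil.
  rewrite big_cons; apply: comb; first exact/rP/mem_head.
  by apply: IHr => b' b'r; apply: rP; rewrite inE b'r orbT.
suff mon a : exists2 z', standard z' & 'X_[a] - z' \in I.
  by rewrite [z]mpolyE; apply: sum_ok.
elim/(wrevlex_ind w_gt0): a => a IHa.
have [[f fI [af amax]]|nEa] := boolp.pselect (initial_of a); last first.
  exists 'X_[a]; last by rewrite subrr; apply: (ideal_pred0 idI).
  by move=> b; rewrite msuppX inE => /eqP ->.
have fa0 : f@_a != 0 by rewrite -mcoeff_msupp.
have [|z' sz' z'I] :=
    sum_ok (rem a (msupp f)) (fun b => - (f@_a)^-1 * f@_b).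
  move=> b; rewrite (rem_filter _ (msupp_uniq f)) mem_filter => /andP[/= ba bf].
  exact/IHa/amax.
exists z' => //.
set s := \sum_(_ <- _) _ in z'I.
have -> : 'X_[a] - z' = (f@_a)^-1%:MP * f + (s - z').
  rewrite addrA; congr (_ - _); rewrite mul_mpolyC {2}[f]mpolyE.
  rewrite (big_rem a) //= scalerDr scalerA mulVf // scale1r -addrA scaler_sumr.
  rewrite -big_split big1 ?addr0 //= => b _.
  by rewrite scalerA -scalerDl mulNr subrr scale0r.
exact: idI.2.
Qed.

Lemma monomial_mem_generated (G : 'X_{1..n} -> Prop) b :
  generated_ideal (fun g => exists2 a, G a & g = 'X_[K, a]) 'X_[b] ->
  exists2 a, G a & (a <= b)%MM.
Proof.
move=> [s sG bE].
have [q qs qb] : exists2 q, q \in s & b \in msupp (q.1 * q.2).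
  apply: boolp.contrapT => nq.
  have : ('X_[b] : {mpoly K[n]})@_b != 0 by rewrite mcoeffX eqxx oner_eq0.
  rewrite {1}bE raddf_sum big1_seq ?eqxx //= => q qs.
  by apply/memN_msupp_eq0/negP => qb; apply: nq; exists q.
have [a Ga q2E] := sG q qs; exists a => //.
rewrite q2E (perm_mem (msuppMX _ _)) in qb; have /mapP[m _ ->] := qb.
exact: lem_addr.
Qed.

Lemma mem_initial_ideal a : initial_ideal w I 'X_[a] <-> initial_of a.
Proof.
split=> [Ia|[f fI af]]; last first.
  by apply: generated_idealP; exists f, a.
have [|b Eb /(initial_of_le Eb)//] := @monomial_mem_generated initial_of a.
apply: generated_ideal_mono Ia => _ [f [b [fI bf ->]]].
by apply: generated_idealP; exists b => //; exists f.
Qed.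

Lemma initial_ideal_generated :
  monomially_generated_by (initial_ideal w I) initial_of.
Proof.
move=> p; split; apply: generated_ideal_mono => g.
  by move=> [f [b [fI bf ->]]]; apply: generated_idealP; exists b => //; exists f.
by move=> [b /mem_initial_ideal]; move=> ? ->.
Qed.

Lemma generated_by_divisors (G : 'X_{1..n} -> Prop) :
  (forall a, G a -> initial_of a) ->
  (forall a, initial_of a -> exists2 b, G b & (b <= a)%MM) ->
  monomially_generated_by (initial_ideal w I) G.
Proof.
move=> GE EG p; rewrite initial_ideal_generated; split.
  apply: generated_ideal_mono => _ [a /EG[b Gb /submK <-] ->].
  rewrite mpolyXD; apply: (ideal_predMl (generated_ideal_pred _)).
  by apply: generated_idealP; exists b.
by apply: generated_ideal_mono => _ [a /GE Ea ->]; apply: generated_idealP; exists a.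
Qed.

Lemma minimal_generator_initial a : minimal_generator (initial_ideal w I) a ->
  initial_of a /\ forall b, initial_of b -> (b <= a)%MM -> b = a.
Proof.
move=> [G [genG minG Ga]].
have GE b : G b -> initial_of b.
  by move=> Gb; apply/mem_initial_ideal/genG/generated_idealP; exists b.
have EG b : initial_of b -> exists2 c, G c & (c <= b)%MM.
  by move=> /mem_initial_ideal/genG/monomial_mem_generated.
split; first exact: GE.
move=> b Eb ba; apply/eqP; apply: contraT => b_neq.
have [c Gc cb] := EG b Eb.
have ca : c != a.
  apply: contra b_neq => /eqP ca; rewrite ca in cb; apply/eqP/mnmP => i.
  by apply/eqP; rewrite eqn_leq (mnm_lepP ba) (mnm_lepP cb).
(* Without a, the set G still generates: what a divided is divided by c. This contradicts the
   minimality of G. *)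
have [] := minG (fun b => G b /\ b != a) _ _ a Ga.
- by move=> b' [].
- apply: generated_by_divisors => [b' [/GE]//|b' /EG[e Ge eb]].
  have [ea|ea] := eqVneq e a; last by exists e.
  by exists c => //; apply: lepm_trans eb; rewrite ea; apply: lepm_trans ba.
- by move=> _; rewrite eqxx.
Qed.

(** Descent on the total degree finds a divisibility-minimal exponent below b; the set of all such
    exponents is the required minimal generating set. *)
Lemma minimal_generator_le b : initial_of b ->
  exists2 a, minimal_generator (initial_ideal w I) a & (a <= b)%MM.
Proof.
pose G a := initial_of a /\ forall b, initial_of b -> (b <= a)%MM -> b = a.
have EG c : initial_of c -> exists2 a, G a & (a <= c)%MM.
  elim: {c}(mdeg c).+1 {-2}c (ltnSn (mdeg c)) => // m IH c cm Ec.
  have [[e [Ee ec ne]]|noe] := boolp.pselect (exists e, [/\ initial_of e, (e <= c)%MM & e <> c]).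
    have [|a Ga ae] := IH e _ Ee.
      rewrite ltnS in cm; apply: leq_trans cm.
      rewrite -(submK ec) mdegD -[X in (X < _)%N]add0n ltn_add2r lt0n mdeg_eq0.
      apply/eqP => ce0; apply: ne.
      by rewrite -(submK ec) ce0 add0m.
    by exists a => //; apply: lepm_trans ec.
  exists c; last exact: lepm_refl.
  split=> // e Ee ec; apply: boolp.contrapT => ne; apply: noe; by exists e.
move=> /EG[a Ga ab]; exists a => //.
exists G; split=> //; first by apply: generated_by_divisors => // c [].
move=> G' G'G genG' c Gc.
have /mem_initial_ideal/genG'/monomial_mem_generated[e G'e ec] := Gc.1.
by rewrite -(Gc.2 e (G'G e G'e).1 ec).
Qed.

End InitialMonomials.

(** * From the initial ideal to Cohen-Macaulayness *)

Section QuotientIdeals.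
Variables (R : comNzRingType) (I : idealr R).
Local Notation S := {ideal_quot I}.

Lemma idealr_pred : ideal_pred (fun x => x \in I).
Proof. by split=> [|a u v uI vI]; [apply: rpred0 | rewrite rpredD // idealMr]. Qed.

Lemma pi_eq0 x : (\pi_S x == 0) = (x \in I).
Proof. by rewrite -[0]pi_zeror -Quotient.idealrBE subr0. Qed.

Lemma pi_eq x y : (\pi_S x == \pi_S y) = (x - y \in I).
Proof. by rewrite -Quotient.idealrBE. Qed.

(** Lets regularity in R/I be tested in R with [add_ideal]. *)
Lemma generated_ideal_pi (l : seq R) z :
  generated_ideal (fun g => g \in map \pi_S l) (\pi_S z) <->
  add_ideal (fun x => x \in I) l z.
Proof.
have idl := add_ideal_pred (fun x => x \in I) l; split; last first.
  apply: (@add_ideal_min _ _ _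
    (fun z => generated_ideal (fun g => g \in map \pi_S l) (\pi_S z))).
  - have idS := generated_ideal_pred (fun g => g \in map \pi_S l).
    split=> [|a u v Iu Iv]; first by rewrite rmorph0; apply: ideal_pred0.
    by rewrite rmorphD rmorphM; apply: idS.2.
  - move=> y; rewrite -pi_eq0 => /eqP ->.
    by apply: ideal_pred0; apply: generated_ideal_pred.
  - by move=> y yl; apply: generated_idealP; apply: map_f.
pose L s := exists2 y, \pi_S y = s & add_ideal (fun x => x \in I) l y.
move=> zP; have [|_ /mapP[g gl ->]|y yz yl] := @generated_ideal_min _ _ L _ _ _ zP.
- split=> [|a _ _ [u <- Iu] [v <- Iv]].
    by exists 0; [apply: rmorph0 | apply: ideal_pred0].
  exists (repr a * u + v); last exact: idl.2.
  by rewrite rmorphD rmorphM /= reprK.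
- by exists g => //; apply: add_ideal_mem.
- apply: (ideal_pred_eqmod idl _ yl); apply: add_ideal_sub.
  by rewrite -pi_eq yz.
Qed.

End QuotientIdeals.

Section CohenMacaulayOfInitial.
Variables (K : fieldType) (n : nat) (w : 'I_n -> nat) (I : idealr {mpoly K[n]}).
Hypothesis w_gt0 : forall i, (0 < w i)%N.
Local Notation R := {mpoly K[n]}.
Local Notation S := {ideal_quot I}.
Local Notation initial := (initial_of w I).

(** The residue field of M is generated over K by the images of the variables, hence algebraic by
    Zariski's lemma. *)
Lemma maximal_ideal_subst_var (M : {pred S}) : maximal_ideal M ->
  exists2 f : 'I_n -> {poly K}, forall i, f i \is monic &
    forall i, \pi_S (subst_var i (f i)) \in M.
Proof.
move=> maxM; have [F [phi [phi_surj phi0]]] := maximal_ideal_residue_field maxM.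
pose psi : {rmorphism R -> F} := phi \o \pi_S.
pose iota : {rmorphism K -> F} := psi \o @mpolyC n K.
have gen : fraction_generated iota [seq psi 'X_i | i <- enum 'I_n].
  move=> L Lc _ Lx LD LM v; have [s <-] := phi_surj v.
  rewrite -[s]reprK -[phi _]/(psi (repr s)).
  move: (repr s); apply: mpoly_ring_ind => [c|i|p q|p q].
  - exact: Lc.
  - by apply: Lx; apply: map_f; rewrite mem_enum.
  - by rewrite rmorphD; apply: LD.
  - by rewrite rmorphM; apply: LM.
have algX i : exists f : {poly K}, f \is monic /\ \pi_S (subst_var i f) \in M.
  have [|p p0 pX] := zariski (fmorph_inj iota) gen (x := psi 'X_i).
    by apply: map_f; rewrite mem_enum.
  exists ((lead_coef p)^-1 *: p); split.
    by rewrite monicE lead_coefZ mulVf ?lead_coef_eq0.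
  apply/phi0; rewrite -[phi _]/(psi _) /subst_var -horner_map -map_poly_comp.
  rewrite -[map_poly _ _]/(map_poly iota _) map_polyZ hornerZ (rootP pX).
  exact: mulr0.
have [f fP] := fin_all_exists algX.
by exists f => i; have [] := fP i.
Qed.

(** By hypothesis, multiplication by x_i preserves standard polynomials; Horner's scheme extends
    this to f(x_i). *)
Lemma standard_mul_subst_var i (f : {poly K}) z :
  (forall b, initial (b + U_(i))%MM -> initial b) ->
  standard w I z -> standard w I (z * subst_var i f).
Proof.
move=> init_i sz; rewrite /subst_var; elim/poly_ind: f => [|f c IHf].
  by rewrite map_poly0 horner0 mulr0; apply: standard0.
rewrite rmorphD rmorphM /= map_polyX map_polyC /= hornerMXaddC mulrDr.
apply: standardD; last by rewrite mulrC mul_mpolyC; apply: standardZ.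
rewrite mulrA; move: {IHf}(z * _) IHf => y sy b.
rewrite (perm_mem (msuppMX _ _)) => /mapP[m my ->]; rewrite addmC => /init_i.
exact: sy.
Qed.

Lemma regular_mod_subst_vars js i (f : 'I_n -> {poly K}) z :
  (forall j, f j \is monic) ->
  (forall j b, j \in i :: js -> initial (b + U_(j))%MM -> initial b) ->
  i \notin js ->
  add_ideal (fun x => x \in I) [seq subst_var j (f j) | j <- js]
    (z * subst_var i (f i)) ->
  add_ideal (fun x => x \in I) [seq subst_var j (f j) | j <- js] z.
Proof.
move=> monf init_js ijs zP; have idI := idealr_pred I.
set l := map _ _ in zP *.
have [z' sz' zz'] := standard_division idI w_gt0 z.
(* The cofactors of the generators are replaced by their standard representatives. *)
have [y [sy yl zyI]] : exists y, [/\ standard w I y,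
    generated_ideal (fun g => g \in l) y & z * subst_var i (f i) - y \in I].
  have idl := generated_ideal_pred (fun g => g \in l).
  case: zP => s sP ->; elim: s sP => [|[c g] s IHs] sP.
    exists 0; split; rewrite ?big_nil ?subrr ?rpred0 //; first exact: standard0.
    exact: ideal_pred0.
  have [|y [sy yl yI]] := IHs; first by move=> q qs; apply: sP; rewrite inE qs orbT.
  rewrite big_cons /=; have [/= gI|/= /mapP[j jjs gE]] := sP _ (mem_head _ _).
    by exists y; split=> //; rewrite -addrA rpredD // idealMr.
  have [c' sc' cI] := standard_division idI w_gt0 c.
  exists (c' * g + y); split.
  - apply: standardD => //; rewrite gE; apply: standard_mul_subst_var => // b.
    by apply: init_js; rewrite inE jjs orbT.
  - by apply: idl.2 => //; apply: generated_idealP; rewrite gE; apply: map_f jjs.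
  - by rewrite opprD addrACA -mulrBl rpredD // mulrC idealMr.
(* Both sides are standard and congruent modulo I, so the relation holds in R itself. *)
have z'E : z' * subst_var i (f i) = y.
  apply/eqP; rewrite -subr_eq0; apply/eqP/(standard_ideal_eq0 (w := w) (I := I)).
    apply: standardD; last by rewrite -scaleN1r; apply: standardZ.
    apply: standard_mul_subst_var => // b; apply: init_js; exact: mem_head.
  have -> : z' * subst_var i (f i) - y =
    (z * subst_var i (f i) - y) - (subst_var i (f i) * (z - z')) by ring.
  by rewrite rpredB // idealMr.
have z'l : generated_ideal (fun g => g \in l) z'.
  by apply: (regular_subst_vars monf ijs); rewrite z'E.
apply: (ideal_pred_eqmod (add_ideal_pred _ _) _ (v := z')); first exact: add_ideal_sub.
by apply: generated_ideal_mono z'l => g gl; apply: generated_idealP; right.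
Qed.

Lemma cohen_macaulay_of_initial (d : nat) (t : 'I_d -> 'I_n) :
  injective t -> is_krull_dim S d ->
  (forall j b, initial (b + U_(t j))%MM -> initial b) -> cohen_macaulay S.
Proof.
move=> injt dimS init_t M maxM; have prM := maximal_ideal_prime maxM.
have [f monf fM] := maximal_ideal_subst_var maxM.
pose g i := subst_var i (f i); pose ts := [seq t j | j <- enum 'I_d].
pose s := [seq \pi_S x | x <- [seq g i | i <- ts]].
have sM : {subset s <= M}.
  by move=> _ /mapP[_ /mapP[i _ ->] ->]; apply: fM.
have size_ts : size ts = d by rewrite size_map size_enum_ord.
have [||heightM gradeM] := height_grade_of_regular dimS prM _ sM; last by exists d.
  split; last first.
    move=> /(generated_ideal_min (prime_ideal_pred prM) sM).
    by apply/negP; apply: prime_ideal_notin1.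
  move=> k; rewrite 2!size_map => k_lt z.
  have [z0 ->] : exists z0, z = \pi_S z0 by exists (repr z); rewrite reprK.
  have i0 : 'I_n by rewrite size_ts in k_lt; apply: (t (Ordinal k_lt)).
  rewrite -map_take (nth_map 0); last by rewrite size_map.
  rewrite -(rmorphM \pi_S) !generated_ideal_pi.
  rewrite -map_take (nth_map i0) //; apply: regular_mod_subst_vars => //.
    move=> j b; rewrite inE => jts; suff /mapP[j' _ ->] : j \in ts by apply: init_t.
    by case/predU1P: jts => [->|/mem_take//]; apply: mem_nth.
  have : uniq ts by rewrite map_inj_uniq // enum_uniq.
  rewrite -[X in uniq X](cat_take_drop k) cat_uniq => /and3P[_ /hasPn nts _].
  by apply: nts; rewrite (drop_nth i0) // mem_head.
by rewrite /s 2!size_map.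
Qed.

End CohenMacaulayOfInitial.

(** * Graded Nakayama for Koszul homology *)

Section WeightedComponents.
Variables (K : fieldType) (n : nat) (w : 'I_n -> nat).
Local Notation R := {mpoly K[n]}.
Implicit Types (p z : R) (m : 'X_{1..n}) (J : R -> Prop).

Local Notation comp := (pihomog (wdeg w)).

Lemma mcoeff_pihomog e p m : (comp e p)@_m = if wdeg w m == e then p@_m else 0.
Proof.
elim/mpolyind: p => [|c m' p _ _ IHp]; first by rewrite raddf0 mcoeff0 if_same.
rewrite linearP /= !mcoeffD !mcoeffZ IHp pihomogX mcoeffX.
have [<-|mm] := eqVneq m' m.
  by case: eqP => _; rewrite ?mcoeffX ?eqxx // mcoeff0 mulr0 add0r.
rewrite [(if wdeg w m' == e then _ else _)@_m]/= mulr0 add0r.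
suff -> : (if wdeg w m' == e then 'X_[m'] else 0 : R)@_m = 0 by rewrite mulr0 add0r.
by case: ifP; rewrite ?mcoeff0 // mcoeffX (negPf mm).
Qed.

Lemma pihomogMX e m z :
  comp e ('X_[m] * z) = if (wdeg w m <= e)%N then 'X_[m] * comp (e - wdeg w m) z else 0.
Proof.
elim/mpolyind: z => [|c m' p _ _ IHp]; first by rewrite mulr0 !raddf0 mulr0 if_same.
rewrite mulrDr pihomogD IHp -scalerAr linearZ /= -mpolyXD pihomogX /= wdeg_add.
case: leqP => me; last first.
  by rewrite gtn_eqF ?scaler0 ?addr0 // ltn_addr.
rewrite linearP /= mulrDr -scalerAr pihomogX.
have -> : (wdeg w m + wdeg w m' == e)%N = (wdeg w m' == e - wdeg w m)%N.
  by apply/eqP/eqP; lia.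
by congr (_ *: _ + _); case: eqP => _; rewrite ?mulr0 ?mpolyXD.
Qed.

(** Reduces the homogeneity of an ideal to a check on its generators. *)
Lemma pihomog_ideal J : ideal_pred J -> ideal_pred (fun z => forall e, J (comp e z)).
Proof.
move=> idJ; split=> [e|a u v Ju Jv e]; first by rewrite raddf0; apply: ideal_pred0.
rewrite pihomogD; apply: ideal_predD => //.
elim/mpolyind: a => [|c m a _ _ IHa]; first by rewrite mul0r raddf0; apply: ideal_pred0.
rewrite mulrDl pihomogD; apply: ideal_predD => //.
rewrite -scalerAl linearZ /= pihomogMX -mul_mpolyC; apply: ideal_predMl => //.
by case: ifP => _; [apply: ideal_predMl | apply: ideal_pred0].
Qed.

(** Unlike a single component, the truncation at weight e fixes p once e is large. *)
Definition trunc e p : R := \sum_(k < e.+1) comp k p.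

Lemma trunc_zmod_morphism e : zmod_morphism (trunc e).
Proof. by move=> p q; rewrite /trunc -sumrB; apply: eq_bigr => k _; rewrite raddfB. Qed.

HB.instance Definition _ e := GRing.isZmodMorphism.Build R R (trunc e) (trunc_zmod_morphism e).

Lemma truncMX e i z : trunc e ('X_i * z) =
  if (w i <= e)%N then 'X_i * trunc (e - w i) z else 0.
Proof.
rewrite /trunc; under eq_bigr => k _ do rewrite pihomogMX wdeg_mnm1.
case: leqP => ie; last by rewrite big1 // => k _; rewrite leqNgt (leq_trans (ltn_ord k)).
rewrite -(big_mkord xpredT
  (fun k => if (w i <= k)%N then 'X_i * comp (k - w i) z else 0)).
rewrite (big_cat_nat (n := w i)) //=; last exact: leqW.
rewrite big_nat big1 ?add0r => [|k /andP[_ ki]]; last by rewrite leqNgt ki.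
rewrite -{1}[w i]add0n big_addn subSn // big_mkord mulr_sumr.
by apply: eq_bigr => k _; rewrite leq_addl addnK.
Qed.

Lemma trunc_id p : exists N, forall e, (N <= e)%N -> trunc e p = p.
Proof.
exists (mmeasure (wdeg w) p) => e pe.
by rewrite /trunc -pihomog_partitionE // ltnW.
Qed.

Variable (I : R -> Prop).
Hypotheses (idI : ideal_pred I) (homI : forall f, I f -> forall e, I (comp e f)).

Lemma trunc_mem e f : I f -> I (trunc e f).
Proof. by move=> If; apply: (ideal_pred_sum idI) => k _ _; apply: homI. Qed.

Local Notation X := (fun i : 'I_n => 'X_i : R).

(** The basis vector of j receives weight [w j], which makes the differential homogeneous of weight
    0. The test guards against the truncated subtraction [e - w j]. *)
Fixpoint ktrunc (js : seq 'I_n) (e : nat) : koszul R (size js) -> koszul R (size js) :=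
  match js with
  | [::] => fun x => trunc e x
  | j :: js' => fun x => (ktrunc e x.1, if (w j <= e)%N then ktrunc (e - w j) x.2 else 0)
  end.

Lemma ktrunc_zmod_morphism js e : zmod_morphism (@ktrunc js e).
Proof.
elim: js e => [|j js IH] e u v; first exact: trunc_zmod_morphism.
apply: koszul_eq; first exact: IH.
change ((if (w j <= e)%N then ktrunc (e - w j) (u.2 - v.2) else 0) =
  (if (w j <= e)%N then ktrunc (e - w j) u.2 else 0) -
  (if (w j <= e)%N then ktrunc (e - w j) v.2 else 0)).
by case: ifP => _; rewrite ?subr0 ?IH.
Qed.

HB.instance Definition _ js e := GRing.isZmodMorphism.Build
  (koszul R (size js)) (koszul R (size js)) (@ktrunc js e) (@ktrunc_zmod_morphism js e).

Lemma ktruncMX js e i (x : koszul R (size js)) : ktrunc e (X i *: x) =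
  if (w i <= e)%N then X i *: ktrunc (e - w i) x else 0.
Proof.
elim: js e x => [|j js IH] e x; first exact: truncMX.
apply: koszul_eq; first by have := IH e x.1; case: ifP.
transitivity (if (w i <= e)%N then
    X i *: (if (w j <= e - w i)%N then ktrunc (e - w i - w j) x.2 else 0) else 0).
  change ((if (w j <= e)%N then ktrunc (e - w j) (X i *: x.2) else 0) =
    if (w i <= e)%N then
    X i *: (if (w j <= e - w i)%N then ktrunc (e - w i - w j) x.2 else 0) else 0).
  rewrite IH; case: (leqP (w i + w j) e) => ije.
    have -> : (w j <= e)%N by lia. have -> : (w i <= e - w j)%N by lia.
    have -> : (w i <= e)%N by lia. have -> : (w j <= e - w i)%N by lia.
    by rewrite subnAC.
  case: (leqP (w j) e) => je; case: (leqP (w i) e) => ie //.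
  - have -> : (w i <= e - w j)%N = false by lia.
    have -> : (w j <= e - w i)%N = false by lia.
    by rewrite scaler0.
  - by have -> : (w i <= e - w j)%N = false by lia.
  - have -> : (w j <= e - w i)%N = false by lia.
    by rewrite scaler0.
by case: ifP.
Qed.

Lemma ktrunc_kdiff js e x : ktrunc e (@kdiff _ _ X js x) = kdiff X (ktrunc e x).
Proof.
elim: js e x => [|j js IH] e x; first exact: (raddf0 (trunc e)).
apply: koszul_eq.
  change (ktrunc e (kdiff X x.1 + X j *: x.2) = kdiff X (ktrunc e x.1) +
    X j *: (if (w j <= e)%N then ktrunc (e - w j) x.2 else 0)).
  by rewrite raddfD /= IH ktruncMX; case: ifP => _; rewrite ?scaler0.
change ((if (w j <= e)%N then ktrunc (e - w j) (- kdiff X x.2) else 0) =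
  - kdiff X (if (w j <= e)%N then ktrunc (e - w j) x.2 else 0)).
by case: ifP => _; rewrite ?raddf0 ?oppr0 // raddfN /= IH.
Qed.

Lemma ktrunc_kmod js e x : kmod I x -> kmod I (@ktrunc js e x).
Proof.
elim: js e x => [|j js IH] e x; first exact: trunc_mem.
case=> [x1 x2]; split; first exact: IH.
change (kmod I (if (w j <= e)%N then ktrunc (e - w j) x.2 else 0)).
by case: ifP => _; [apply: IH | apply: kmod0].
Qed.

Lemma ktrunc_kfil js e i x : kfil i x -> kfil i (@ktrunc js e x).
Proof.
elim: js e i x => [|j js IH] e i x.
  by case: i => // i x0; rewrite [x]x0; apply: (raddf0 (trunc e)).
case=> [x1 x2]; split; first exact: IH.
change (kfil i.-1 (if (w j <= e)%N then ktrunc (e - w j) x.2 else 0)).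
by case: ifP => _; [apply: IH | apply: kfil0].
Qed.

Lemma ktrunc_id js x : exists N, forall e, (N <= e)%N -> @ktrunc js e x = x.
Proof.
elim: js x => [|j js IH] x; first exact: trunc_id.
have [N1 N1P] := IH x.1; have [N2 N2P] := IH x.2.
exists (maxn N1 (w j + N2)) => e; rewrite geq_max => /andP[e1 e2].
apply: koszul_eq; first exact: N1P.
change ((if (w j <= e)%N then ktrunc (e - w j) x.2 else 0) = x.2).
by rewrite (leq_trans (leq_addr _ _) e2) N2P // -(addKn (w j) N2) leq_sub2r.
Qed.

Hypothesis w_gt0 : forall i, (0 < w i)%N.

(* Graded Nakayama: X_j acts surjectively on the first Koszul homology of js,
   hence the latter vanishes. *)
Lemma kacyclic_consK j js : kacyclic X I (j :: js) 1 -> kacyclic X I js 1.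
Proof.
move=> acy a a1 Ja; have [N /(_ N (leqnn N))] := ktrunc_id a.
suff [g g2 gP] : exists2 g, kfil 2 g & kmod I (ktrunc N a - kdiff X g).
  by move=> aN; exists g => //; rewrite -aN.
elim/ltn_ind: N a a1 Ja => e IHe a a1 Ja.
(* Modulo I, a = d g + x_j u. After truncation at e, only the part of u of weight at most e - w_j
   matters, and the induction hypothesis makes it a boundary. *)
have [g [u [g2 u1 Ju auP]]] := kacyclic_behead idI acy a1 Ja.
have := ktrunc_kmod e auP; rewrite raddfB raddfD /= ktrunc_kdiff ktruncMX.
case: leqP => je.
  have [|h h2 hP] := IHe (e - w j)%N _ u u1 Ju.
    by rewrite ltn_subrL w_gt0 (leq_trans _ je).
  move=> aP; exists (ktrunc e g + X j *: h).
    by apply: kfilD; [apply: ktrunc_kfil | apply: kfilZ].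
  have -> : ktrunc e a - kdiff X (ktrunc e g + X j *: h) =
      (ktrunc e a - (kdiff X (ktrunc e g) + X j *: ktrunc (e - w j) u)) +
      X j *: (ktrunc (e - w j) u - kdiff X h).
    rewrite raddfD /= linearZ /= scalerBr !opprD !addrA; congr (_ - _).
    by rewrite subrK.
  by apply: kmodD => //; apply: kmodZ.
by rewrite addr0 => aP; exists (ktrunc e g) => //; apply: ktrunc_kfil.
Qed.

(** Heads are removed one at a time by [kacyclic_consK], until the k-th entry comes first. *)
Lemma kacyclic_regular_drop js k z i0 : (k < size js)%N -> kacyclic X I js 1 ->
  add_ideal I [seq X i | i <- drop k.+1 js] (z * 'X_(nth i0 js k)) ->
  add_ideal I [seq X i | i <- drop k.+1 js] z.
Proof.
elim: js k => [|j js IH] [|k] //= k_lt acy.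
  by rewrite drop0; apply: (kacyclic_regular idI acy).
by apply: IH => //; apply: kacyclic_consK acy.
Qed.

End WeightedComponents.

(** * From Cohen-Macaulayness to Koszul acyclicity *)

Section HomogeneousQuotient.
Variables (K : fieldType) (n d : nat) (w : 'I_n -> nat) (I : idealr {mpoly K[n]}).
Hypotheses (w_gt0 : forall i, (0 < w i)%N) (homI : whomogeneous_ideal w I).
Local Notation R := {mpoly K[n]}.
Local Notation A := {mpoly K[d]}.
Local Notation S := {ideal_quot I}.

Let idI : ideal_pred (fun x => x \in I) := idealr_pred I.

(** Stated for the image under a morphism, so as to serve for A inside R, for R and for S. *)
Lemma mpoly_sub_mcoeff0 (k : nat) (T : comNzRingType) (f : {rmorphism {mpoly K[k]} -> T})
    (J : T -> Prop) p :
  ideal_pred J -> (forall i, J (f 'X_i)) -> J (f (p - (p@_0%MM)%:MP)).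
Proof.
move=> idJ JX; elim/mpoly_ring_ind: p => [c|i|p q Jp Jq|p q Jp Jq].
- by rewrite mpolyCK subrr rmorph0; apply: ideal_pred0.
- by rewrite mcoeffX mnm1_eq0 mpolyC0 subr0.
- have -> : p + q - ((p + q)@_0%MM)%:MP = (p - (p@_0%MM)%:MP) + (q - (q@_0%MM)%:MP).
    by rewrite mcoeffD mpolyCD opprD addrACA.
  by rewrite rmorphD; apply: ideal_predD.
- have -> : p * q - ((p * q)@_0%MM)%:MP =
      p * (q - (q@_0%MM)%:MP) + (q@_0%MM)%:MP * (p - (p@_0%MM)%:MP).
    by rewrite rmorphM /= mpolyCM; ring.
  by rewrite rmorphD !rmorphM; apply: ideal_predD => //; apply: ideal_predMl.
Qed.

(** As the weights are positive, the component of weight 0 is the constant term; if nonzero, it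
    would be a unit in the proper ideal I. *)
Lemma ideal_mcoeff0 f : f \in I -> f@_0%MM = 0.
Proof.
move=> /homI/(_ 0%N) fI; apply/eqP; apply: contraT => f0.
suff : 1 \in I by rewrite idealr1.
have -> : 1 = (f@_0%MM)^-1%:MP * pihomog (wdeg w) 0 f :> R.
  apply/mpolyP => m; rewrite mcoeffCM mcoeff_pihomog mcoeff1.
  have -> : (wdeg w m == 0%N) = (m == 0%MM).
    apply/eqP/eqP => [m0|->]; last exact: wdeg0.
    by apply/eqP; rewrite -mdeg_eq0 -leqn0 -m0 mdeg_le_wdeg.
  by have [->|_] := eqVneq m 0%MM; rewrite ?mulr0 // mulVf.
exact: idealMr.
Qed.

(** Independent of the representative, by [ideal_mcoeff0]. *)
Definition irrelevant : {pred S} := fun s => (repr s)@_0%MM == 0.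

Lemma mem_irrelevant p : (\pi_S p \in irrelevant) = (p@_0%MM == 0).
Proof.
have : repr (\pi_S p) - p \in I by rewrite -pi_eq reprK.
by move=> /ideal_mcoeff0/eqP; rewrite mcoeffB subr_eq0 => /eqP h; rewrite unfold_in h.
Qed.

Lemma irrelevant_maximal : maximal_ideal irrelevant.
Proof.
split=> [|J idJ MJ s Js].
  split; first by rewrite -[0](rmorph0 \pi_S) mem_irrelevant mcoeff0.
    by rewrite -[1](rmorph1 \pi_S) mem_irrelevant mcoeff1 eqxx oner_eq0.
  move=> a u v; rewrite -[a]reprK -[u]reprK -[v]reprK -rmorphM -rmorphD !mem_irrelevant.
  by move=> /eqP u0 /eqP v0; rewrite mcoeffD rmorphM /= u0 v0 mulr0 addr0.
have idJ' := idealr_closed_pred idJ.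
rewrite -[s]reprK mem_irrelevant; apply: contraT => c0.
have : \pi_S (repr s - ((repr s)@_0%MM)%:MP) \in J.
  by apply: MJ; rewrite mem_irrelevant mcoeffB mpolyCK subrr.
rewrite rmorphB /= reprK => /(ideal_predB idJ' Js); rewrite opprB addrC subrK.
move=> /(ideal_predMl idJ' (\pi_S ((repr s)@_0%MM)^-1%:MP)).
rewrite -rmorphM /= -mpolyCM mulVf // mpolyC1 rmorph1.
by case: idJ => _ /negbTE ->.
Qed.

Variable (t : 'I_d -> 'I_n).

Definition last_vars_embed : A -> R := comp_mpoly [tuple 'X_(t j) | j < d].

HB.instance Definition _ := GRing.RMorphism.on last_vars_embed.

Definition last_vars_proj : {rmorphism A -> S} := \pi_S \o last_vars_embed.

Lemma last_vars_embedX j : last_vars_embed 'X_j = 'X_(t j).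
Proof. by rewrite /last_vars_embed /comp_mpoly mmapX mmap1U tnth_mktuple. Qed.

Hypotheses (inj_proj : injective last_vars_proj) (int_proj : integralRange last_vars_proj).

Let ts := [seq t j | j <- enum 'I_d].
Let J := add_ideal (fun x => x \in I) [seq 'X_i | i <- ts].

Let idJ : ideal_pred J := add_ideal_pred _ _.

Lemma last_vars_ideal_var j : J 'X_(t j).
Proof. by apply: add_ideal_mem; apply: map_f; apply: map_f; rewrite mem_enum. Qed.

Lemma last_vars_ideal_homogeneous z : J z -> forall e, J (pihomog (wdeg w) e z).
Proof.
apply: (@add_ideal_min _ _ _ (fun z => forall e, J (pihomog (wdeg w) e z))).
  exact: (pihomog_ideal w idJ).
  by move=> y yI e; apply: add_ideal_sub; apply: homI.
move=> _ /mapP[i its ->] e; rewrite -['X_i]mulr1 pihomogMX.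
case: ifP => _; last exact: ideal_pred0.
by apply: ideal_predMr => //; apply: add_ideal_mem; apply: map_f.
Qed.

(* The component of degree m w_i of an integral equation of degree m for x_i
   reduces to x_i ^ m modulo the variables of A. *)
Lemma var_nilpotent i : exists m, J ('X_i ^+ m).
Proof.
have [p /monicP p1 /rootP p0] := int_proj (\pi_S 'X_i).
have p_neq0 : p != 0 by rewrite -lead_coef_eq0 p1 oner_eq0.
pose m := (size p).-1; exists m.
have pX : \sum_(l < m) last_vars_embed p`_l * 'X_i ^+ l + 'X_i ^+ m \in I.
  rewrite -pi_eq0 rmorphD rmorphXn raddf_sum; apply/eqP/(etrans _ p0).
  rewrite (horner_coef_wide (n := m.+1)); last first.
    by rewrite (leq_trans (size_poly _ _)) // leqSpred.
  rewrite big_ord_recr; congr (_ + _).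
    by apply: eq_bigr => l _; rewrite /= rmorphM rmorphXn coef_map.
  rewrite coef_map; have -> : p`_(@ord_max m) = 1 by rewrite -p1.
  by rewrite -[X in _ = X * _]/(last_vars_proj 1) rmorph1 mul1r.
(* Replacing the coefficients by their constant terms changes the equation by an element of J
   only. *)
pose q := \sum_(l < m) ((p`_l)@_0%MM)%:MP * 'X_i ^+ l + 'X_i ^+ m : R.
have Jq : J q.
  have JpX : J (\sum_(l < m) last_vars_embed p`_l * 'X_i ^+ l + 'X_i ^+ m).
    exact: add_ideal_sub.
  apply: (ideal_pred_eqmod idJ _ JpX); rewrite opprD addrACA subrr addr0 -sumrB.
  apply: ideal_pred_sum => // l _ _; rewrite -mulrBl -opprB mulNr.
  apply: ideal_predN => //; apply: ideal_predMr => //.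
  have := mpoly_sub_mcoeff0 (f := last_vars_embed) p`_l idJ _.
  rewrite rmorphB /= [last_vars_embed _%:MP]comp_mpolyC; apply => j.
  by rewrite last_vars_embedX; apply: last_vars_ideal_var.
have Xw k : wdeg w (U_(i) *+ k)%MM = (k * w i)%N.
  elim: k => [|k IHk]; first by rewrite mulm0n wdeg0.
  by rewrite mulmS wdeg_add IHk wdeg_mnm1 mulSn.
have := last_vars_ideal_homogeneous Jq (m * w i).
rewrite /q pihomogD raddf_sum /= mpolyXn pihomogX /= Xw eqxx big1 ?add0r // => l _.
rewrite mul_mpolyC linearZ /= mpolyXn pihomogX /= Xw eqn_pmul2r // ltn_eqF //.
exact: scaler0.
Qed.

Lemma prime_last_vars_irrelevant (P : {pred S}) : prime_ideal P ->
  (forall j, last_vars_proj 'X_j \in P) -> P =i irrelevant.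
Proof.
move=> prP PX; have idealP := prime_ideal_pred prP.
have JP z : J z -> \pi_S z \in P.
  apply: (@add_ideal_min _ _ _ (fun z => \pi_S z \in P))
    => [|y|_ /mapP[_ /mapP[j _ ->] ->]].
  - split=> [|a u v Pu Pv]; first by rewrite rmorph0; apply: (ideal_pred0 idealP).
    by rewrite rmorphD rmorphM; apply: idealP.2.
  - by rewrite -pi_eq0 => /eqP ->; apply: (ideal_pred0 idealP).
  - by rewrite -last_vars_embedX; apply: PX.
have PXi i : \pi_S 'X_i \in P.
  have [m /JP] := var_nilpotent i; rewrite rmorphXn; exact: prime_idealX.
have MP : {subset irrelevant <= P}.
  move=> s; rewrite -[s]reprK mem_irrelevant => /eqP s0.
  have := @mpoly_sub_mcoeff0 n S \pi_S (fun x => x \in P) (repr s) idealP PXi.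
  by rewrite s0 mpolyC0 subr0.
by move=> s; apply/idP/idP; [apply: irrelevant_maximal.2 => //; case: prP | apply: MP].
Qed.

(** The quotient of A by its first k variables, realised as an endomorphism of A; its kernel is the
    prime (t_1, ..., t_k). *)
Definition kill_vars (k : nat) : A -> A :=
  comp_mpoly [tuple if (j < k)%N then 0 else 'X_j | j < d].

HB.instance Definition _ k := GRing.RMorphism.on (kill_vars k).

Lemma kill_varsX k j : kill_vars k 'X_j = if (j < k)%N then 0 else 'X_j.
Proof. by rewrite /kill_vars /comp_mpoly mmapX mmap1U tnth_mktuple. Qed.

Lemma kill_varsS k a : kill_vars k.+1 (kill_vars k a) = kill_vars k.+1 a.
Proof.
apply: (mpoly_rmorph_eq (f := kill_vars k.+1 \o kill_vars k) (g := kill_vars k.+1)) => [c|j] /=.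
  by rewrite {2}/kill_vars comp_mpolyC.
rewrite !kill_varsX ltnS; case: (ltngtP j k) => jk; rewrite ?rmorph0 //.
- by rewrite kill_varsX ltnS leqNgt jk.
- by rewrite kill_varsX ltnS jk leqnn.
Qed.

(* Going up along the chain (0) < (t_1) < ... < (t_1, ..., t_d) of A. *)
Lemma irrelevant_chain : chain_to d irrelevant.
Proof.
suff chain k : (k <= d)%N -> exists P, [/\ chain_to k P, prime_ideal P,
    forall a, last_vars_proj a \in P -> kill_vars k a = 0 &
    forall j : 'I_d, (j < k)%N -> last_vars_proj 'X_j \in P].
  have [P [[C prC CP] prP _ PX]] := chain d (leqnn d).
  exists C => // s; rewrite CP; apply: prime_last_vars_irrelevant => // j; exact: PX.
(* The first prime avoids the images of the nonzero elements of A, among which 0 does not occur by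
   injectivity. *)
elim: k => [_|k IH k_lt].
  have [|||P [prP _ PT]] := @prime_avoiding S (fun s => s = 0)
    (fun s => exists2 a, a != 0 & s = last_vars_proj a).
  - by split=> // a u v -> ->; rewrite mulr0 addr0.
  - split; first by exists 1; rewrite ?oner_eq0 ?rmorph1.
    move=> _ _ [a a0 ->] [b b0 ->]; exists (a * b); first by rewrite mulf_neq0.
    by rewrite rmorphM.
  - move=> _ -> [a a0 /esym/eqP]; rewrite raddf_eq0 //; exact/negP.
  exists P; split=> //; first exact: chain_to0.
  move=> a aP; have -> : kill_vars 0 a = a.
    by rewrite -[RHS]comp_mpoly_id /kill_vars; congr (_ \mPo _); apply: eq_mktuple.
  by apply: contraTeq aP => a0; apply: PT; exists a.
have [P [chP prP Pker PX]] := IH (ltnW k_lt).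
pose j0 := Ordinal k_lt; have idealP := prime_ideal_pred prP.
have [|||P' [prP' JP' PT']] := @prime_avoiding S
    (add_ideal (fun s => s \in P) [:: last_vars_proj 'X_j0])
    (fun s => exists2 a, kill_vars k.+1 a != 0 & s = last_vars_proj a).
- exact: add_ideal_pred.
- split; first by exists 1; rewrite ?rmorph1 ?oner_eq0.
  move=> _ _ [a a0 ->] [b b0 ->]; exists (a * b); last by rewrite rmorphM.
  by rewrite rmorphM mulf_neq0.
(* Suppose a = c t_(k+1) modulo P, with c a root of a monic q of degree m. The homogenised F in a
   and t_(k+1) maps into P, hence is killed by [kill_vars k], whereas [kill_vars k.+1] sends it to
   the m-th power of the image of a, which is nonzero. *)
- move=> s sJ [a a0 sE]; move: sJ; rewrite {}sE => /(add_ideal1 _ _ idealP)[c cP].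
  have [q /monicP q1 /rootP q0] := int_proj c.
  set m := (size q).-1 in q1; have q_m : q`_m = 1 by rewrite -q1.
  pose F := \sum_(l < m.+1) q`_l * 'X_j0 ^+ (m - l) * a ^+ l.
  have FP : last_vars_proj F \in P.
    set x := last_vars_proj a in cP *; set y := last_vars_proj 'X_j0 in cP *.
    have -> : last_vars_proj F =
        \sum_(l < m.+1) last_vars_proj q`_l * y ^+ (m - l) * (x ^+ l - (c * y) ^+ l).
      under [RHS]eq_bigr => l _ do rewrite mulrBr.
      rewrite sumrB [X in _ - X](_ : _ = 0) ?subr0.
        rewrite (rmorph_sum last_vars_proj); apply: eq_bigr => l _.
        by rewrite 2!(rmorphM last_vars_proj) 2!(rmorphXn last_vars_proj).
      have := congr1 (fun z => y ^+ m * z) q0; rewrite mulr0; apply: etrans.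
      rewrite (horner_coef_wide (n := m.+1)); last first.
        by rewrite (leq_trans (size_poly _ _)) // leqSpred.
      rewrite mulr_sumr; apply: eq_bigr => l _; rewrite coef_map exprMn /=.
      have -> : y ^+ m = y ^+ (m - l) * y ^+ l by rewrite -exprD subnK // -ltnS.
      ring.
    apply: (ideal_pred_sum idealP) => l _ _; apply: (ideal_predMl idealP).
    by rewrite subrXX; apply: (ideal_predMr idealP).
  have : kill_vars k.+1 F = kill_vars k.+1 a ^+ m.
    rewrite /F big_ord_recr /= q_m mul1r subnn mul1r rmorphD rmorphXn raddf_sum /=.
    rewrite big1 ?add0r // => l _; rewrite !rmorphM rmorphXn /= kill_varsX leqnn.
    by rewrite expr0n subn_eq0 leqNgt ltn_ord mulr0 mul0r.
  rewrite -kill_varsS Pker // rmorph0 => /esym/eqP; rewrite expf_eq0 (negPf a0).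
  by rewrite andbF.
exists P'; split=> //.
- apply: chain_toS chP prP' _; split; first by move=> s sP; apply: JP'; apply: add_ideal_sub.
  exists (last_vars_proj 'X_j0).
    by apply: JP'; apply: add_ideal_mem; rewrite inE.
  apply/negP => /Pker; rewrite kill_varsX ltnn => /eqP.
  by rewrite -msupp_eq0 msuppX.
- by move=> a aP; apply: contraTeq aP => a0; apply: PT'; exists a.
- move=> j; rewrite ltnS leq_eqVlt => /orP[/eqP jk|/PX jP].
    have -> : j = j0 by apply: val_inj.
    by apply: JP'; apply: add_ideal_mem; rewrite inE.
  by apply: JP'; apply: add_ideal_sub.
Qed.

Lemma cohen_macaulay_kacyclic : cohen_macaulay S ->
  kacyclic (fun i : 'I_n => 'X_i : R) (fun x => x \in I) ts 1.
Proof.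
move=> /(_ _ irrelevant_maximal)[h [_ hmax] [[s [[reg _] sM sh]] _]].
have dh : (d <= h)%N by have [C prC CP] := irrelevant_chain; apply: hmax prC CP.
pose ys := map repr s; have sE : s = map \pi_S ys.
  by rewrite -map_comp -[LHS]map_id; apply: eq_map => x; rewrite /= reprK.
apply: (koszul_acyclic (ys := ys)) => //.
- move=> k; rewrite size_map => k_lt z.
  have := reg k k_lt (\pi_S z).
  have -> : s`_k = \pi_S ys`_k by rewrite sE (nth_map 0) // size_map.
  by rewrite sE -map_take -rmorphM !generated_ideal_pi.
(* If no power of y were in J, a prime over J would avoid them all. By [var_nilpotent] it contains
   every variable, hence y, which has no constant term. *)
- move=> y yys; apply: boolp.contrapT => ny.
  have y0 : y@_0%MM == 0.
    by rewrite -mem_irrelevant; apply: sM; rewrite sE map_f.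
  have [|||P [prP JP PT]] := @prime_avoiding R J (fun x => exists N, x = y ^+ N).
  - exact: add_ideal_pred.
  - split; first by exists 0%N.
    by move=> _ _ [k1 ->] [k2 ->]; exists (k1 + k2)%N; rewrite exprD.
  - by move=> x Jx [N xE]; apply: ny; exists N; rewrite -xE.
  have idealP := prime_ideal_pred prP.
  have PX i : 'X_i \in P by have [m /JP] := var_nilpotent i; apply: prime_idealX.
  have := @mpoly_sub_mcoeff0 n R idfun (fun x => x \in P) y idealP PX.
  rewrite (eqP y0) mpolyC0 subr0; apply/negP/PT; by exists 1%N.
- have -> : size ts = d by rewrite size_map size_enum_ord.
  by rewrite size_map sh add1n ltnS.
Qed.

End HomogeneousQuotient.

(** * From regularity to the initial ideal *)

Section InitialOfRegular.
Variables (K : fieldType) (n : nat) (w : 'I_n -> nat) (I : idealr {mpoly K[n]}).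
Hypothesis homI : whomogeneous_ideal w I.
Local Notation R := {mpoly K[n]}.

Let idI : ideal_pred (fun x => x \in I) := idealr_pred I.

Lemma mcoeff_generated_vars (ls : seq 'I_n) (h : R) (c : 'X_{1..n}) :
  generated_ideal (fun g => g \in [seq 'X_i | i <- ls]) h ->
  (forall l, l \in ls -> c l = 0%N) -> h@_c = 0.
Proof.
move=> [s sP ->] c0; rewrite raddf_sum big1_seq //= => q qs.
have /mapP[l lls ->] := sP q qs; apply/memN_msupp_eq0.
rewrite (perm_mem (msuppMX _ _)); apply/negP => /mapP[m _ cE].
by have := c0 l lls; rewrite cE mnmDE mnm1E eqxx.
Qed.

Lemma add_ideal_split (l : seq R) z : add_ideal (fun x => x \in I) l z ->
  exists2 f, f \in I & generated_ideal (fun g => g \in l) (z - f).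
Proof.
have idl := generated_ideal_pred (fun g => g \in l).
apply: (@add_ideal_min _ _ _
  (fun z => exists2 f, f \in I & generated_ideal (fun g => g \in l) (z - f))).
- split=> [|a u v [f1 f1I h1] [f2 f2I h2]].
    by exists 0; [apply: rpred0 | rewrite subrr; apply: ideal_pred0].
  exists (a * f1 + f2); first exact: idI.2.
  have -> : a * u + v - (a * f1 + f2) = a * (u - f1) + (v - f2) by ring.
  exact: idl.2.
- by move=> y yI; exists y; rewrite ?subrr //; apply: ideal_pred0.
- move=> y yl; exists 0; first exact: rpred0.
  by rewrite subr0; apply: generated_idealP.
Qed.

(* The terms of f not divisible by a variable after x_i are all divisible by
   x_i, so that f = x_i g modulo these variables; regularity of x_i lifts g to
   an element of I with the same initial monomial. *)
Lemma initial_of_sub_var (i : 'I_n) (ls : seq 'I_n) (a : 'X_{1..n}) :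
  (forall l : 'I_n, (l \in ls) = (i < l)%N) ->
  (forall z, add_ideal (fun x => x \in I) [seq 'X_l | l <- ls] (z * 'X_i) ->
    add_ideal (fun x => x \in I) [seq 'X_l | l <- ls] z) ->
  (0 < a i)%N -> (forall l : 'I_n, (i < l)%N -> a l = 0%N) ->
  initial_of w I a -> initial_of w I (a - U_(i))%MM.
Proof.
move=> lsE reg ai0 al0 [f0 f0I [af0 amax]].
pose f := pihomog (wdeg w) (wdeg w a) f0; have fI : f \in I by apply: homI.
have fE m : f@_m = if wdeg w m == wdeg w a then f0@_m else 0 by apply: mcoeff_pihomog.
have supp_f m : m \in msupp f -> wdeg w m = wdeg w a /\ (m != a -> wrevlex_gt w a m).
  rewrite mcoeff_msupp fE; case: ifP => [/eqP e|_]; rewrite ?eqxx // -mcoeff_msupp.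
  by move=> /amax.
have fa0 : f@_a != 0 by rewrite fE eqxx -mcoeff_msupp.
(* The exponents that survive modulo the variables after x_i. *)
pose low (m : 'X_{1..n}) := [forall l : 'I_n, (i < l)%N ==> (m l == 0%N)].
have lowP m (l : 'I_n) : low m -> (i < l)%N -> m l = 0%N.
  by move=> /forallP/(_ l)/implyP h /h /eqP.
have low_a : low a by apply/forallP => l; apply/implyP => /al0 ->.
(* If m is smaller than a with the same weight, it exceeds a at the last place k where they differ.
   Both vanish after i, so k is at most i, and m i is at least a i. *)
have low_i m : m \in msupp f -> low m -> (U_(i) <= m)%MM.
  move=> mf lm; rewrite lep1mP -lt0n; have [->//|ma] := eqVneq m a.
  have [ew amf] := supp_f m mf.
  case: (amf ma) => [|[_ [k [akm akE]]]]; first by rewrite ew ltnn.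
  case: (ltngtP i k) => [ik|/akE <-//|/val_inj ik].
    by move: akm; rewrite (lowP _ _ lm ik).
  by rewrite ik; apply: leq_trans akm.
pose c := (a - U_(i))%MM; have Ua : (U_(i) <= a)%MM by rewrite lep1mP -lt0n.
pose g : R := \sum_(m <- msupp f | low m) f@_m *: 'X_[m - U_(i)].
have gcoef m : g@_m = if low (m + U_(i))%MM then f@_(m + U_(i)) else 0.
  rewrite /g raddf_sum /=; case: (boolP (low (m + U_(i))%MM && ((m + U_(i))%MM \in msupp f))).
    move=> /andP[lm mf]; rewrite lm big_mkcond (bigD1_seq (m + U_(i))%MM) ?msupp_uniq //=.
    rewrite lm mcoeffZ addmK mcoeffX eqxx mulr1 big_seq_cond big1 ?addr0 //.
    move=> m' /andP[m'f m'm]; case: ifP => // lm'; rewrite mcoeffZ mcoeffX.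
    case: eqP => [e|]; rewrite ?mulr0 //.
    by case/eqP: m'm; rewrite -e submK // low_i.
  move=> nm; rewrite big_seq_cond big1; last first.
    move=> m' /andP[m'f lm']; rewrite mcoeffZ mcoeffX; case: eqP => [e|]; rewrite ?mulr0 //.
    by case/negP: nm; rewrite -e submK ?low_i // lm' m'f.
  by case: ifP => // lm; move: nm; rewrite lm => /memN_msupp_eq0 ->.
have low_c m : low m -> low (m + U_(i))%MM.
  move=> lm; apply/forallP => l; apply/implyP => il.
  rewrite mnmDE (lowP m) // mnm1E.
  by case: (i =P l) il => [<-|]; rewrite ?ltnn.
have cE : (c + U_(i))%MM = a by rewrite submK.
have gc : g@_c = f@_a by rewrite gcoef cE low_a.
have /reg/add_ideal_split[f' f'I hP] :
    add_ideal (fun x => x \in I) [seq 'X_l | l <- ls] (g * 'X_i).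
  have idls := add_ideal_pred (fun x => x \in I) [seq 'X_l | l <- ls].
  have -> : g * 'X_i = f - \sum_(m <- msupp f | ~~ low m) f@_m *: 'X_[m].
    rewrite [X in _ = X - _]mpolyE (bigID low) /= addrK mulr_suml.
    rewrite big_seq_cond [in RHS]big_seq_cond; apply: eq_bigr => m /andP[mf lm].
    by rewrite -scalerAl -mpolyXD submK ?low_i.
  apply: ideal_predB => //; first exact: add_ideal_sub.
  apply: ideal_pred_sum => // m _; rewrite negb_forall => /existsP[l].
  rewrite negb_imply => /andP[il ml]; rewrite -mul_mpolyC; apply: ideal_predMl => //.
  have Ulm : (U_(l) <= m)%MM by rewrite lep1mP.
  rewrite -(submK Ulm) mpolyXD; apply: ideal_predMl => //.
  by apply: add_ideal_mem; apply: map_f; rewrite lsE.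
have f'low m : low m -> f'@_m = g@_m.
  move=> lm; apply/eqP; rewrite eq_sym -subr_eq0 -mcoeffB; apply/eqP.
  by apply: mcoeff_generated_vars hP _ => l; rewrite lsE => /lowP; apply.
have lowc : low c.
  apply/forallP => l; apply/implyP => il; rewrite mnmBE al0 //.
(* The lift f' need not be homogeneous; only its component of the weight of c is kept. *)
pose f'' := pihomog (wdeg w) (wdeg w c) f'.
have f''E m : f''@_m = if wdeg w m == wdeg w c then f'@_m else 0.
  exact: mcoeff_pihomog.
exists f''; first exact: homI.
split; first by rewrite mcoeff_msupp f''E eqxx f'low // gc.
move=> m; rewrite mcoeff_msupp f''E; case: ifP => [/eqP ewm|_]; rewrite ?eqxx // => f'm mc.
(* A non-low m involves a variable after x_i while c does not, so at equal weight it is smaller. A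
   low m is a monomial of g, and is compared with c after multiplication by x_i. *)
have [lm|] := boolP (low m); last first.
  rewrite negb_forall => /existsP[l0]; rewrite negb_imply => hl0.
  have [l /andP[il ml] lmax] :=
    @arg_maxnP _ l0 (fun l : 'I_n => (i < l)%N && (m l != 0%N)) val hl0.
  right; split=> //; exists l; split=> [|k lk]; first by rewrite (lowP c) // lt0n.
  have ik := ltn_trans il lk; rewrite (lowP c) //; apply/esym/eqP.
  by apply: contraLR lk => mk; rewrite -leqNgt; apply: lmax; rewrite ik.
apply/(wrevlex_gt_add2r w U_(i)%MM); rewrite cE.
rewrite f'low // gcoef low_c // in f'm.
have [_] : wdeg w (m + U_(i))%MM = wdeg w a /\
   ((m + U_(i))%MM != a -> wrevlex_gt w a (m + U_(i))%MM).
  by apply: supp_f; rewrite mcoeff_msupp.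
by apply; rewrite -cE eqm_add2r.
Qed.

End InitialOfRegular.

(** * The equivalence *)

Lemma last_var_inj (n d : nat) (d_le_n : (d <= n)%N) : injective (last_var d_le_n).
Proof. by move=> i j /(congr1 val) /= /addnI /val_inj. Qed.

Theorem proposition2 (K : fieldType) (n d : nat) (w : 'I_n -> nat)
    (I : idealr {mpoly K[n]}) (d_le_n : (d <= n)%N) :
  infinite_type K ->
  (forall i : 'I_n, (0 < w i)%N) ->
  whomogeneous_ideal w I ->
  is_krull_dim {ideal_quot I} d ->
  (1 <= d)%N ->
  last_vars_noether_normalization d_le_n I ->
  cohen_macaulay {ideal_quot I} <->
  (forall a : 'X_{1..n}, minimal_generator (initial_ideal w I) a ->
     forall j : 'I_d, ~~ (U_(last_var d_le_n j) <= a)%MM).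
Proof.
move=> _ w_gt0 homI dimS _ [injA intA]; have idI := idealr_pred I.
split=> [cmS a /(minimal_generator_initial idI)[Ea amin] j|cond]; last first.
  apply: (cohen_macaulay_of_initial w_gt0 (@last_var_inj n d d_le_n) dimS) => j b Eb.
  (* A minimal generator dividing b + t_j does not involve t_j, so it already divides b. *)
  have [a mina ab] := minimal_generator_le idI Eb.
  have a_t : a (last_var d_le_n j) = 0%N.
    by apply/eqP; have := cond a mina j; rewrite lep1mP negbK.
  apply: (initial_of_le idI (minimal_generator_initial idI mina).1).
  apply/mnm_lepP => i; have := mnm_lepP ab i; rewrite mnmDE mnm1E.
  by case: eqP => [<-|_]; rewrite ?a_t // addn0.
rewrite lep1mP; apply/negP => aj.
(* The last variable dividing x^a comes no earlier than t_j, so it is one of the t's itself, at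
   position k of [ts]. *)
have [i ai imax] := @arg_maxnP _ (last_var d_le_n j) (fun i => a i != 0%N) val aj.
have ni : (n - d <= i)%N by apply: leq_trans (imax _ aj); apply: leq_addr.
have id : (i - (n - d) < d)%N by have := ltn_ord i; lia.
pose k := Ordinal id; have kE : k = (i - (n - d))%N :> nat by [].
pose ts := [seq last_var d_le_n j | j <- enum 'I_d].
have size_ts : size ts = d by rewrite size_map size_enum_ord.
have nth_ts l : (l < d)%N -> nth i ts l = (n - d + l)%N :> nat.
  by move=> ld; rewrite (nth_map k) ?size_enum_ord //= nth_enum_ord.
have tsi : nth i ts k = i by apply: ord_inj; rewrite nth_ts //= subnKC.
have lsE (l : 'I_n) : (l \in drop k.+1 ts) = (i < l)%N.
  apply/idP/idP => [/(nthP i)[m]|il].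
    rewrite size_drop size_ts nth_drop => mk <-.
    by rewrite nth_ts; lia.
  have ld : (l - (n - d) < d)%N by have := ltn_ord l; lia.
  have -> : l = nth i (drop k.+1 ts) (l - (n - d) - k.+1).
    by apply: ord_inj; rewrite nth_drop nth_ts; lia.
  by apply: mem_nth; rewrite size_drop size_ts; lia.
have acy := cohen_macaulay_kacyclic w_gt0 homI injA intA cmS.
have reg z : add_ideal (fun x => x \in I) [seq 'X_l | l <- drop k.+1 ts] (z * 'X_i) ->
    add_ideal (fun x => x \in I) [seq 'X_l | l <- drop k.+1 ts] z.
  rewrite -{1}tsi; apply: (kacyclic_regular_drop idI homI w_gt0) acy.
  by rewrite size_ts.
have ai0 : (0 < a i)%N by rewrite lt0n.
have al0 (l : 'I_n) : (i < l)%N -> a l = 0%N.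
  by move=> il; apply/eqP; apply: contraLR il => /imax; rewrite -leqNgt.
(* By minimality, a - U_i would equal a. *)
have /amin := initial_of_sub_var homI lsE reg ai0 al0 Ea.
move=> /(_ (lem_subr _ _)) /(congr1 (fun m : 'X_{1..n} => m i)).
by rewrite mnmBE mnm1E eqxx; lia.
Qed.
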